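(* Let $S$ be a surface of finite type, let $0<\lambda<1/2$, and let $C_\lambda\subset S$ be the standard ternary Cantor set with parameter $\lambda$ embedded in $S$. Let $\Gamma$ be a finitely generated subgroup of $\mathcal{M}^{\infty}(S,C_\lambda)$. Then one of the following holds: (1) $\Gamma$ contains a free subgroup on two generators; (2) $\Gamma$ has a finite orbit, i.e. there exists $p\in C_\lambda$ such that the set $\Gamma(p):=\{g(p)\mid g\in\Gamma\}$ is finite.
   Context: Surfaces are connected and oriented. For a closed subset $K\subset S$, $\mathrm{Diff}(S,K)$ is the group of orientation-preserving $C^\infty$-diffeomorphisms $f$ of $S$ with $f(K)=K$, $\mathrm{Diff}_0(S,K)$ is its identity component, and $\mathcal{M}^{\infty}(S,K)=\mathrm{Diff}(S,K)/\mathrm{Diff}_0(S,K)$. When $K$ is a Cantor set, elements of $\mathrm{Diff}_0(S,K)$ act trivially on $K$, so $\mathcal{M}^{\infty}(S,K)$ acts on $K$ by homeomorphisms (by restriction of representatives). Standard ternary Cantor set with parameter $\lambda\in(0,1/2)$: start with $\mathcal I_0=\{[0,1]\}$; $\mathcal I_n$ is the collection of $2^n$ closed intervals of length $\lambda^n$ obtained by removing from each $I\in\mathcal I_{n-1}$ its open middle subinterval of length $(1-2\lambda)|I|$; the Cantor set is $\bigcap_{n\ge 0}\bigcup_{I\in\mathcal I_n}I\subset[0,1]$. It is embedded in $S$ by means of a smooth embedding of the segment $[0,1]$ in $S$, and its image in $S$ is again denoted $C_\lambda$. *)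

(* Defs.v *)
From HB Require Import structures.
From mathcomp Require Import all_boot all_order all_algebra.
From mathcomp Require Import all_classical all_reals all_analysis.

Set Implicit Arguments.
Unset Strict Implicit.
Unset Printing Implicit Defensive.

Import Order.TTheory GRing.Theory Num.Theory.
Import numFieldNormedType.Exports.

Local Open Scope classical_set_scope.
Local Open Scope ring_scope.

Definition iter_derive {R : realType} {V W : normedModType R}
    (vs : seq V) (f : V -> W) : V -> W :=
  foldr (fun v g => 'D_v g) f vs.

(* C^oo on a set A, which is open wherever this is used: every iterated
   directional derivative of f is (Frechet) differentiable at the points of A. *)
Definition smooth_on {R : realType} {V W : normedModType R}
    (A : set V) (f : V -> W) : Prop :=
  forall (vs : seq V) (x : V), A x -> differentiable (iter_derive vs f) x.

(* A homeomorphism from an open subset of T onto an open subset of R^2; the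
   values of chart_map outside chart_dom, and those of chart_inv outside the
   image of chart_dom, are irrelevant. *)
Record chart (R : realType) (T : topologicalType) := Chart {
  chart_dom : set T;
  chart_map :> T -> 'rV[R]_2;
  chart_inv : 'rV[R]_2 -> T;
  open_chart_dom : open chart_dom;
  open_chart_cod : open (chart_map @` chart_dom);
  chart_mapK : forall x, chart_dom x -> chart_inv (chart_map x) = x;
  chart_continuous : forall x, chart_dom x -> {for x, continuous chart_map};
  chart_inv_continuous :
    forall y, (chart_map @` chart_dom) y -> {for y, continuous chart_inv} }.

(* f read in the charts c and c', and the domain on which this makes sense. *)
Definition local_rep {R : realType} {T T' : topologicalType}
    (c : chart R T) (c' : chart R T') (f : T -> T') : 'rV[R]_2 -> 'rV[R]_2 :=
  c' \o f \o chart_inv c.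

Definition local_dom {R : realType} {T T' : topologicalType}
    (c : chart R T) (c' : chart R T') (f : T -> T') (A : set T) : set 'rV[R]_2 :=
  c @` (A `&` chart_dom c `&` f @^-1` chart_dom c').

(* Connected oriented smooth surface without boundary.  The atlas need not be
   maximal; its transition maps have positive Jacobian determinant, so it fixes
   both the smooth structure and the orientation. *)
Record surface (R : realType) := Surface {
  surface_sort :> topologicalType;
  atlas : set (chart R surface_sort);
  surface_hausdorff : hausdorff_space surface_sort;
  surface_second_countable : @second_countable surface_sort;
  surface_connected : connected [set: surface_sort];
  atlas_cover : forall x, exists2 c, atlas c & chart_dom c x;
  atlas_smooth : forall c c', atlas c -> atlas c' ->
    smooth_on (local_dom c c' id setT) (local_rep c c' id);
  atlas_oriented : forall c c', atlas c -> atlas c' ->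
    forall y, local_dom c c' id setT y -> 0 < \det ('J (local_rep c c' id) y) }.

(* Smoothness of f on the open subset A of S. *)
Definition smooth_map_on {R : realType} {S S' : surface R}
    (A : set S) (f : S -> S') : Prop :=
  (forall x, A x -> {for x, continuous f}) /\
  (forall c c', atlas c -> atlas c' ->
     smooth_on (local_dom c c' f A) (local_rep c c' f)).

(* Finite type: diffeomorphic to a closed surface with finitely many points
   removed; j is the inverse of i on the complement of P. *)
Definition finite_type {R : realType} (S : surface R) : Prop :=
  exists (S' : surface R) (P : set S') (i : S -> S') (j : S' -> S),
    [/\ compact [set: S'] /\ finite_set P,
        cancel i j /\ range i = ~` P,
        smooth_map_on setT i &
        smooth_map_on (~` P) j].

Definition diffeomorphism {R : realType} {S : surface R} (f : S -> S) : Prop :=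
  smooth_map_on setT f /\
  exists g : S -> S, [/\ cancel f g, cancel g f & smooth_map_on setT g].

Definition orientation_preserving {R : realType} {S : surface R}
    (f : S -> S) : Prop :=
  forall c c', atlas c -> atlas c' ->
    forall y, local_dom c c' f setT y -> 0 < \det ('J (local_rep c c' f) y).

Definition selfmap {R : realType} (S : surface R) : Type := S -> S.

HB.instance Definition _ (R : realType) (S : surface R) :=
  gen_eqMixin (selfmap S).
HB.instance Definition _ (R : realType) (S : surface R) :=
  gen_choiceMixin (selfmap S).

Definition cinfty_nbhs {R : realType} {S : surface R}
    (f : selfmap S) (c c' : chart R S) (L : set S) (vs : seq 'rV[R]_2) (e : R) :
    set (selfmap S) :=
  [set g : selfmap S | g @` L `<=` chart_dom c' /\
    forall x, L x ->
      `|iter_derive vs (local_rep c c' g) (c x)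
        - iter_derive vs (local_rep c c' f) (c x)| < e].

(* The sets cinfty_nbhs with smooth centre f are a subbase of the C^oo
   compact-open topology (uniform convergence of all derivatives on compact
   sets).  Only its trace on sets of smooth maps is meaningful; the other
   elements of selfmap S never matter. *)
Definition cinfty_subbase {R : realType} (S : surface R) :
    set (set (selfmap S)) :=
  [set N | exists (f : selfmap S) (c c' : chart R S) (L : set S) vs e,
     [/\ smooth_map_on setT f, atlas c /\ atlas c',
         [/\ compact L, L `<=` chart_dom c & f @` L `<=` chart_dom c'],
         0 < e & N = cinfty_nbhs f c c' L vs e]].

HB.instance Definition _ (R : realType) (S : surface R) :=
  @isSubBaseTopological.Build (selfmap S) (set (selfmap S))
    (@cinfty_subbase R S) id.

(* Diff(S, K), its identity component, and M(S, K) = Diff(S, K) / Diff_0(S, K)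
   as a set of left cosets. *)
Definition Diff {R : realType} {S : surface R} (K : set S) : set (selfmap S) :=
  [set f : selfmap S |
     [/\ diffeomorphism f, orientation_preserving f & f @` K = K]].

Definition Diff0 {R : realType} {S : surface R} (K : set S) : set (selfmap S) :=
  connected_component (Diff K) (id : selfmap S).

Definition mcg {R : realType} {S : surface R} (K : set S) :
    set (set (selfmap S)) :=
  [set [set ((f : S -> S) \o h : selfmap S) | h in Diff0 K] | f in Diff K].

(* Diff_0(S, K) is a normal subgroup, so the operations of the quotient group
   are the elementwise ones on cosets, and its unit is Diff0 K itself. *)
Definition mcg_mul {R : realType} {S : surface R} (A B : set (selfmap S)) :
    set (selfmap S) :=
  [set ((f : S -> S) \o g : selfmap S) | f in A & g in B].

Definition mcg_inv {R : realType} {S : surface R} (A : set (selfmap S)) :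
    set (selfmap S) :=
  [set g : selfmap S | exists2 f : selfmap S, A f & cancel f g /\ cancel g f].

Definition is_subgroup {R : realType} {S : surface R} (K : set S)
    (G : set (set (selfmap S))) : Prop :=
  [/\ G `<=` mcg K, G (Diff0 K),
      forall A B, G A -> G B -> G (mcg_mul A B) &
      forall A, G A -> G (mcg_inv A)].

Definition finitely_generated {R : realType} {S : surface R} (K : set S)
    (G : set (set (selfmap S))) : Prop :=
  exists F : set (set (selfmap S)),
    [/\ finite_set F, F `<=` G & G = smallest (is_subgroup K) F].

(* Words in a, b and their inverses: (false, _) stands for a, (true, _) for b,
   and the second component is true for the inverse of the letter. *)
Definition reduced (w : seq (bool * bool)) : bool :=
  sorted (fun x y => ~~ ((x.1 == y.1) && (x.2 != y.2))) w.

Definition eval_word {R : realType} {S : surface R} (K : set S)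
    (A B : set (selfmap S)) (w : seq (bool * bool)) : set (selfmap S) :=
  foldr (fun x C => let X := if x.1 then B else A in
                    mcg_mul (if x.2 then mcg_inv X else X) C) (Diff0 K) w.

Definition contains_free2 {R : realType} {S : surface R} (K : set S)
    (G : set (set (selfmap S))) : Prop :=
  exists A B, [/\ G A, G B &
    forall w, w != [::] -> reduced w -> eval_word K A B w <> Diff0 K].

(* G(p), the action of a class on K being that of its representatives. *)
Definition mcg_orbit {R : realType} {S : surface R}
    (G : set (set (selfmap S))) (p : S) : set S :=
  [set q | exists A (f : selfmap S), [/\ G A, A f & q = f p]].

(* Endpoints of the 2 ^ n intervals of level n. *)
Fixpoint cantor_intervals {R : realType} (l : R) (n : nat) : seq (R * R) :=
  if n is m.+1 then
    flatten [seq [:: (J.1, J.1 + l * (J.2 - J.1)); (J.2 - l * (J.2 - J.1), J.2)]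
            | J <- cantor_intervals l m]
  else [:: (0, 1)].

Definition ternary_cantor {R : realType} (l : R) : set R :=
  \bigcap_n \bigcup_(J in [set` cantor_intervals l n]) `[J.1, J.2]%classic.

(* A smooth embedding of [0, 1]; smoothness up to the endpoints means that g is
   smooth on an open neighbourhood U of [0, 1]. *)
Definition smooth_embedding01 {R : realType} {S : surface R} (g : R -> S) :
    Prop :=
  [/\ exists U : set R, [/\ open U, `[0, 1]%classic `<=` U,
        forall t, U t -> {for t, continuous g} &
        forall c, atlas c -> smooth_on (U `&` g @^-1` chart_dom c) (c \o g)],
      {in `[0, 1] &, injective g} &
      forall c t, atlas c -> t \in `[0, 1] -> chart_dom c (g t) ->
        derive1 (c \o g) t != 0].

(* Main.v *)
(** If [f] is a diffeomorphism of [S] preserving the Cantor set [C_l], then read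
    through the embedded segment it is strictly differentiable along [C_l] with
    non-zero derivative. It maps gaps to gaps, and the lengths of gaps are powers
    of [l] up to a constant factor, so the derivative is locally constant and [f]
    is locally affine on [C_l]: on addresses, it replaces a prefix by another one
    and possibly complements the remaining digits. Classes in the identity
    component act trivially on [C_l], so [G] acts through a finitely generated
    group [H] of such homeomorphisms of the Cantor space.

    For [a] in [H], a periodic point is neutral, attracting or repelling. The
    attracting and repelling points are finite in number, the neutral set is
    clopen, and outside it the powers of [a] have north-south dynamics. If some
    point is neutral for all of [H], then by finite generation its orbit is
    finite, since along an orbit of unbounded expansion one finds an element
    contracting a cylinder around that point. Otherwise, [a ^ n b ^ m] with
    [n >> m >> 1] has neutral set inside that of [a] and that of [b], so by
    compactness some [a] in [H] has no neutral point. If no orbit is finite,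
    Neumann's lemma gives [h] in [H] moving the finite set of attracting and
    repelling points of [a] off itself, and large powers of [a] and of
    [h a h^-1] play ping-pong. *)

Require Import Defs.
From mathcomp Require Import all_boot all_order all_algebra.
From mathcomp Require Import all_classical all_reals all_analysis.
From mathcomp Require Import zify ring lra.

Set Implicit Arguments.
Unset Strict Implicit.
Unset Printing Implicit Defensive.

Import Order.TTheory GRing.Theory Num.Theory.
Import numFieldNormedType.Exports.

(** * Prefix replacement maps of the Cantor space *)

Notation stream := (nat -> bool).

Definition app (u : seq bool) (w : stream) : stream :=
  fun i => nth (w (i - size u)) u i.
Definition flip (e : bool) (w : stream) : stream := fun i => e (+) w i.
Definition lflip (e : bool) (s : seq bool) : seq bool := map (addb e) s.
Definition pre (n : nat) (x : stream) : seq bool := mkseq x n.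
Definition incyl (u : seq bool) (x : stream) : bool := pre (size u) x == u.

Lemma size_pre n x : size (pre n x) = n. Proof. exact: size_mkseq. Qed.
Lemma size_lflip e s : size (lflip e s) = size s. Proof. exact: size_map. Qed.

Lemma app_nil w : app [::] w = w.
Proof. by apply/funext => i; rewrite /app /= nth_nil subn0. Qed.

Lemma app_cat u v w : app (u ++ v) w = app u (app v w).
Proof.
apply/funext => i; rewrite /app nth_cat size_cat subnDA.
case: ltnP => h; first by apply: set_nth_default.
by rewrite (nth_default _ h).
Qed.

Lemma flip_app e u w : flip e (app u w) = app (lflip e u) (flip e w).
Proof.
apply/funext => i; rewrite /app /flip size_lflip; case: (ltnP i (size u)) => h.
  by rewrite (nth_map (w (i - size u))).
by rewrite !nth_default ?size_lflip.
Qed.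

Lemma flip0 w : flip false w = w. Proof. by apply/funext. Qed.
Lemma flipD e e' w : flip e (flip e' w) = flip (e (+) e') w.
Proof. by apply/funext => i; rewrite /flip addbA. Qed.
Lemma flipK e w : flip e (flip e w) = w.
Proof. by rewrite flipD addbb flip0. Qed.

Lemma app_inj u : injective (app u).
Proof.
move=> w w' h; apply/funext => i.
have /(congr1 (fun f => f (size u + i))) := h.
by rewrite /app !nth_default ?leq_addr // addKn.
Qed.

Lemma pre_app u w : pre (size u) (app u w) = u.
Proof.
apply: (@eq_from_nth _ false); rewrite size_pre // => i hi.
by rewrite nth_mkseq // /app; apply: set_nth_default.
Qed.

Lemma incyl_app u w : incyl u (app u w).
Proof. by rewrite /incyl pre_app. Qed.

Lemma incyl_pre n x : incyl (pre n x) x.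
Proof. by rewrite /incyl size_pre. Qed.

Lemma app_pre n x : app (pre n x) (fun i => x (n + i)) = x.
Proof.
apply/funext => i; rewrite /app size_pre; case: (ltnP i n) => h.
  by rewrite nth_mkseq.
by rewrite nth_default ?size_pre // subnKC.
Qed.

Lemma incylP u x : reflect (exists w, x = app u w) (incyl u x).
Proof.
apply: (iffP eqP) => [<-|[w ->]]; last exact: pre_app.
by exists (fun i => x (size u + i)); rewrite app_pre.
Qed.

Lemma incyl_nil x : incyl [::] x.
Proof. by rewrite /incyl. Qed.

Lemma incyl_catl u s x : incyl (u ++ s) x -> incyl u x.
Proof. by move=> /incylP[w ->]; rewrite app_cat incyl_app. Qed.

Lemma pre_cat n m x : pre (n + m) x = pre n x ++ pre m (fun i => x (n + i)).
Proof.
rewrite /pre /mkseq iotaD map_cat add0n; congr (_ ++ _).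
rewrite -[X in iota X _]addn0 iotaDl -map_comp; exact: eq_map.
Qed.

Lemma incyl_cat u v x : incyl u x -> incyl v x -> size u <= size v ->
  exists s, v = u ++ s.
Proof.
move=> /eqP hu /eqP hv h; rewrite -hv -(subnKC h) pre_cat hu.
by eexists.
Qed.

Lemma incyl_size u v x : incyl u x -> incyl v x -> size u = size v -> u = v.
Proof. by move=> /eqP hu /eqP hv h; rewrite -hu -hv h. Qed.

Lemma pre_cat_le n m x : n <= m -> exists s, pre m x = pre n x ++ s.
Proof. by move=> h; apply: incyl_cat (incyl_pre n x) (incyl_pre m x) _; rewrite !size_pre. Qed.

Lemma incyl_pre_le n m x y : n <= m -> incyl (pre m x) y -> incyl (pre n x) y.
Proof. by move=> /(pre_cat_le x) [s ->]; apply: incyl_catl. Qed.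

Lemma stream_eqP x y : (forall n, incyl (pre n x) y) -> x = y.
Proof.
move=> h; apply/funext => i; have := h i.+1; rewrite /incyl size_pre => /eqP.
move/(congr1 (fun s => nth false s i)); by rewrite !nth_mkseq.
Qed.

Lemma stream_neq x y : x <> y -> exists n, ~~ incyl (pre n x) y.
Proof.
move=> h; apply: contrapT => h1; apply: h; apply: stream_eqP => n.
by apply: contrapT => /negP h2; apply: h1; exists n.
Qed.

Lemma incyl_rcons u x : incyl u x -> incyl (rcons u false) x \/ incyl (rcons u true) x.
Proof.
move=> /eqP hu; have e : pre (size u).+1 x = rcons u (x (size u)).
  by rewrite -addn1 pre_cat hu -cats1 /pre /mkseq /= addn0.
by case E : (x (size u)); [right|left]; rewrite /incyl size_rcons e E.
Qed.

Lemma stream_split (x y : stream) : x <> y -> exists u b, incyl (rcons u b) x /\ incyl (rcons u (~~ b)) y.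
Proof.
move=> h; have hex : exists i, x i != y i.
  apply: contrapT => hn; apply: h; apply/funext => i; apply: contrapT => hi.
  by apply: hn; exists i; apply/eqP.
have [i hi hmin] := ex_minnP hex.
have hp : pre i y = pre i x.
  apply: (@eq_from_nth _ false); rewrite !size_pre // => j hj.
  rewrite !nth_mkseq //; apply/eqP; rewrite eq_sym; apply: contraT => /hmin; lia.
have hr z : pre i.+1 z = rcons (pre i z) (z i).
  by rewrite -addn1 pre_cat -cats1 /pre /mkseq /= addn0.
exists (pre i x), (x i); rewrite /incyl !size_rcons size_pre !hr hp; split=> //.
by move: hi; case: (x i); case: (y i).
Qed.

(* Bar induction, used in place of compactness of the Cantor space. *)
Lemma cantor_bar (P : seq bool -> Prop) :
  (forall u, P (rcons u false) -> P (rcons u true) -> P u) ->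
  (forall x, exists n, P (pre n x)) -> P [::].
Proof.
move=> hs hx; apply: contrapT => h0.
pose b u := `[< P (rcons u false) >].
pose f n := iter n (fun u => rcons u (b u)) [::].
have hf n : ~ P (f n).
  elim: n => // n IH /= h; apply: IH; apply: hs; last first.
    by move: h; rewrite -/(f n); rewrite /b; case: asboolP.
  by apply: contrapT => h1; move: h; rewrite -/(f n) /b; case: asboolP.
pose x n := b (f n).
have [n] := hx x; suff -> : pre n x = f n by apply: hf.
elim: n => // n IH; rewrite /= -/(f n) -IH /pre /mkseq -addn1 iotaD map_cat /= cats1.
by rewrite -/(mkseq x n) -/(pre n x) {3}IH.
Qed.

(** Compactness as it is used below, with [P u] read as a property of the cylinder of [u]: what
    holds near every point and can be glued from two halves holds globally. *)
Lemma cantor_bar_cover (P : seq bool -> Prop) :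
  (forall u s, P u -> P (u ++ s)) ->
  (forall u, P (rcons u false) -> P (rcons u true) -> P u) ->
  (forall x, exists2 u, incyl u x & P u) -> forall u, P u.
Proof.
move=> he hs hx u; rewrite -[u]cat0s; apply: he.
apply: cantor_bar => // x; have [v hv hP] := hx x.
by exists (size v); rewrite (eqP hv).
Qed.

(** * Affine maps between cylinders *)

Definition aff (phi : stream -> stream) (u v : seq bool) (e : bool) :=
  forall w, phi (app u w) = app v (flip e w).

Lemma aff_comp phi psi u v w e e' :
  aff phi u v e -> aff psi v w e' -> aff (psi \o phi) u w (e' (+) e).
Proof. by move=> h h' z; rewrite /= h h' flipD. Qed.

Lemma aff_ext phi u v e s : aff phi u v e -> aff phi (u ++ s) (v ++ lflip e s) e.
Proof. by move=> h w; rewrite !app_cat h flip_app. Qed.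

Lemma aff_incyl phi u v e x : aff phi u v e -> incyl u x -> incyl v (phi x).
Proof. by move=> h /incylP[w ->]; rewrite h incyl_app. Qed.

(** If [v'] were a proper extension of [v], the digit at position [size v] would be constant on the
    right, while on the left it varies with the first digit of [w]. *)
Lemma app_flip_size v v' e e' :
  (forall w, app v (flip e w) = app v' (flip e' w)) -> size v' <= size v.
Proof.
move=> h; rewrite leqNgt; apply/negP => hlt.
have [s hs] : exists s, v' = v ++ s.
  apply: (@incyl_cat _ _ (app v (flip e xpred0))); rewrite ?incyl_app //.
    by rewrite h incyl_app.
  exact: ltnW.
have {}h w : flip e w = app s (flip e' w) by apply: (@app_inj v); rewrite h hs app_cat.
move: hlt; rewrite hs size_cat; case: s h {hs} => [|b s] h; first by rewrite addn0 ltnn.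
have := congr1 (fun f => f 0) (h xpred0); have := congr1 (fun f => f 0) (h xpredT).
by rewrite /flip /app /= => <-; case: e {h}.
Qed.

Lemma aff_uniq phi u v v' e e' : aff phi u v e -> aff phi u v' e' -> v = v' /\ e = e'.
Proof.
move=> h h'; have h1 w : app v (flip e w) = app v' (flip e' w) by rewrite -h -h'.
have hv : v = v'.
  apply: (@incyl_size _ _ (app v (flip e xpred0))); first exact: incyl_app.
    by rewrite h1 incyl_app.
  by apply/eqP; rewrite eqn_leq (app_flip_size h1) (app_flip_size (fun w => esym (h1 w))).
split=> //; have := h1 xpred0; rewrite hv => /app_inj/(congr1 (fun f => f 0)).
by rewrite /flip !addbF.
Qed.

Lemma aff_inv phi psi u v e : cancel phi psi -> aff phi u v e -> aff psi v u e.
Proof. by move=> hK h w; rewrite -{1}(flipK e w) -h hK. Qed.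

Definition unif (N : nat) (phi : stream -> stream) :=
  forall u, N <= size u -> exists v e, aff phi u v e.

(** By compactness: two halves with depths [N] and [M] give depth [(maxn N M).+1] below their
    parent. *)
Lemma unif_local phi :
  (forall x, exists u, incyl u x /\ exists v e, aff phi u v e) -> exists N, unif N phi.
Proof.
move=> h.
suff [N hN] : exists N, forall s, N <= size s -> exists v e, aff phi ([::] ++ s) v e.
  by exists N.
elim/cantor_bar_cover: [::] => [u s [N hN]|u [N hN] [M hM]|x].
- by exists N => t ht; rewrite -catA; apply: hN; rewrite size_cat (leq_trans ht) // leq_addl.
- exists (maxn N M).+1 => -[//|[] s] hs; rewrite -cat_rcons.
    by apply: hM; move: hs => /=; lia.
  by apply: hN; move: hs => /=; lia.
- have [u [hu [v [e ha]]]] := h x; exists u => //; exists 0 => s _.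
  by exists (v ++ lflip e s), e; apply: aff_ext.
Qed.

(* Thompson's group V, enlarged by the maps that also complement all the digits
   after the replaced prefix. *)
Record vaut := Vaut {
  vfun :> stream -> stream;
  vinv : stream -> stream;
  vfunK : cancel vfun vinv;
  vinvK : cancel vinv vfun;
  vunif : exists N, unif N vfun }.

Lemma vaut_eq (a b : vaut) : vfun a =1 vfun b -> a = b.
Proof.
case: a b => f f' K K' U [g g' L L' V] /= /funext h.
have h' : f' = g' by apply/funext => x; rewrite -{1}(L' x) -h K.
by subst g g'; congr Vaut; apply: Prop_irrelevance.
Qed.

Lemma vinv_unif (a : vaut) : exists N, unif N (vinv a).
Proof.
apply: unif_local => y; have [N hN] := vunif a.
have [|v [e h]] := hN (pre N (vinv a y)); first by rewrite size_pre.
exists v; split; last by exists (pre N (vinv a y)), e; apply: aff_inv h; apply: vfunK.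
by rewrite -(vinvK a y); apply: aff_incyl h _; apply: incyl_pre.
Qed.

Definition vV (a : vaut) : vaut := Vaut (@vinvK a) (@vfunK a) (vinv_unif a).

Lemma vone_unif : exists N, unif N id.
Proof. by exists 0 => u _; exists u, false => w; rewrite flip0. Qed.
Definition v1 : vaut := @Vaut id id (fun=> erefl) (fun=> erefl) vone_unif.

Lemma local_aff (a : vaut) x : exists u, incyl u x /\ exists v e, aff a u v e.
Proof.
have [N h] := vunif a; exists (pre N x); split; first exact: incyl_pre.
by apply: h; rewrite size_pre.
Qed.

Lemma unif_comp (a b : vaut) : exists N, unif N (a \o b).
Proof.
apply: unif_local => x; have [N hN] := vunif a; have [M hM] := vunif b.
have [|v [e h]] := hM (pre (M + N) x); first by rewrite size_pre leq_addr.
have [u [hu [u' [e' h']]]] := local_aff b x.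
exists (pre (N + size u) x); split; first exact: incyl_pre.
have [s hs] : exists s, pre (N + size u) x = u ++ s.
  by apply: incyl_cat hu (incyl_pre _ _) _; rewrite size_pre leq_addl.
have hN' : N <= size (u' ++ lflip e' s).
  have := congr1 size hs; rewrite size_pre !size_cat size_lflip; lia.
have [z [e1 h1]] := hN _ hN'.
exists z, (e1 (+) e'); rewrite hs; exact: aff_comp (aff_ext _ h') h1.
Qed.

Definition vM (a b : vaut) : vaut :=
  Vaut (can_comp (@vfunK a) (@vfunK b)) (can_comp (@vinvK b) (@vinvK a)) (unif_comp a b).

Definition vX (a : vaut) (n : nat) : vaut := iter n (vM a) v1.

Lemma vME a b x : vM a b x = a (b x). Proof. by []. Qed.
Lemma vXE a n x : vX a n x = iter n a x.
Proof. by elim: n => //= n IH; rewrite IH. Qed.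
Lemma vVE (a : vaut) x : vV a (a x) = x. Proof. exact: vfunK. Qed.
Lemma vEV (a : vaut) x : a (vV a x) = x. Proof. exact: vinvK. Qed.
Lemma vVK a : vV (vV a) = a. Proof. exact: vaut_eq. Qed.
Lemma vfun_inj (a : vaut) : injective a. Proof. exact: can_inj (@vfunK a). Qed.
Lemma vXD a n m : vX a (n + m) = vM (vX a n) (vX a m).
Proof. by apply: vaut_eq => x; rewrite vME !vXE iterD. Qed.
Lemma vXM a n m : vX a (n * m) = vX (vX a n) m.
Proof.
elim: m => [|m IH]; first by rewrite muln0.
by rewrite mulnS vXD IH.
Qed.
Lemma vX1 a : vX a 1 = a. Proof. exact: vaut_eq. Qed.
Lemma vXVK a n x : vX (vV a) n (vX a n x) = x.
Proof.
elim: n x => // n IH x; rewrite -{1}addn1 vXD vX1 vME.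
by rewrite [vX a n.+1 x]/(a (vX a n x)) vVE IH.
Qed.
Lemma vXVK' a n x : vX a n (vX (vV a) n x) = x.
Proof. by rewrite -{1}(vVK a) vXVK. Qed.
Lemma vXV a n : vX (vV a) n = vV (vX a n).
Proof. by apply: vaut_eq => x; apply: (@vfun_inj (vX a n)); rewrite vXVK' vEV. Qed.

Lemma affM (a b : vaut) u v w e e' :
  aff b u v e -> aff a v w e' -> aff (vM a b) u w (e' (+) e).
Proof. exact: aff_comp. Qed.
Lemma affV (a : vaut) u v e : aff a u v e -> aff (vV a) v u e.
Proof. by apply: aff_inv; apply: vfunK. Qed.

(** * The derivative cocycle *)

Local Open Scope ring_scope.

(* The derivative of [a] at [x] along the ternary Cantor set is [l ^ kz a x] up
   to sign, so that [kz] is a cocycle. *)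
Definition kz (a : vaut) (x : stream) : int :=
  xget 0 [set z : int | exists u v e,
    [/\ incyl u x, aff a u v e & z = (size v)%:Z - (size u)%:Z]].

Lemma aff_size (a : vaut) u v e u' v' e' x : incyl u x -> incyl u' x ->
  aff a u v e -> aff a u' v' e' -> (size v)%:Z - (size u)%:Z = (size v')%:Z - (size u')%:Z.
Proof.
wlog le : u u' v v' e e' / (size u <= size u')%N.
  move=> h hu hu' ha ha'; case/orP: (leq_total (size u) (size u')) => hs.
    exact: h hs hu hu' ha ha'.
  by symmetry; apply: h hs hu' hu ha' ha.
move=> hu hu' ha ha'; have [s es] := incyl_cat hu hu' le.
subst u'; have [-> _] := aff_uniq ha' (aff_ext s ha).
rewrite !size_cat size_lflip; lia.
Qed.

Lemma kzE (a : vaut) u v e x : incyl u x -> aff a u v e -> kz a x = (size v)%:Z - (size u)%:Z.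
Proof.
move=> hu ha; rewrite /kz; case: xgetP => [z _ [u' [v' [e' [hu' ha' ->]]]]|].
  exact: aff_size hu' hu ha' ha.
by move=> /(_ ((size v)%:Z - (size u)%:Z)) []; exists u, v, e.
Qed.

Lemma kzM a b x : kz (vM a b) x = kz a (b x) + kz b x.
Proof.
have [u [hu [v [e h]]]] := local_aff b x; have [N hN] := vunif a.
have hu1 := incyl_pre (N + size u) x.
have [|s hs] := incyl_cat hu hu1; first by rewrite size_pre leq_addl.
have hN' : (N <= size (v ++ lflip e s))%N.
  have := congr1 size hs; rewrite size_pre !size_cat size_lflip; lia.
have [z [e1 h1]] := hN _ hN'.
have h2 := aff_ext s h; rewrite hs in hu1.
rewrite (kzE hu1 (affM h2 h1)) (kzE hu1 h2) (kzE (aff_incyl h2 hu1) h1); lia.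
Qed.

Lemma kz1 x : kz v1 x = 0.
Proof. by rewrite (@kzE v1 [::] [::] false) ?incyl_nil // => w; rewrite flip0. Qed.

Lemma kzV a x : kz (vV a) (a x) = - kz a x.
Proof.
have : kz (vM (vV a) a) x = 0 by rewrite (_ : vM _ _ = v1) ?kz1 //; apply: vaut_eq => y; rewrite vME vVE.
by rewrite kzM => /eqP; rewrite addr_eq0 => /eqP.
Qed.

Lemma kzXD a n m x : kz (vX a (n + m)) x = kz (vX a n) (vX a m x) + kz (vX a m) x.
Proof. by rewrite vXD kzM. Qed.

Lemma kzXM a n m x : vX a n x = x -> kz (vX a (n * m)) x = kz (vX a n) x *+ m.
Proof.
move=> hx; elim: m => [|m IH]; first by rewrite muln0 kz1.
rewrite mulnS addnC kzXD hx IH; rewrite mulrS addrC; congr (_ + _).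
Qed.

Lemma kz_lb a : exists N : nat, forall x, - N%:Z <= kz a x.
Proof.
have [N hN] := vunif a; exists N => x.
have [|v [e h]] := hN (pre N x); first by rewrite size_pre.
rewrite (kzE (incyl_pre N x) h) size_pre; lia.
Qed.

Lemma kz_bound a : exists N : nat, forall x, - N%:Z <= kz a x <= N%:Z.
Proof.
have [N hN] := kz_lb a; have [M hM] := kz_lb (vV a); exists (N + M)%N => x.
have := hN x; have := hM (a x); rewrite kzV; lia.
Qed.

Lemma kzX_bound a : exists N : nat, forall n x, - (n * N)%:Z <= kz (vX a n) x <= (n * N)%:Z.
Proof.
have [N hN] := kz_bound a; exists N => n x; elim: n => [|n IH]; first by rewrite kz1.
rewrite /= kzM; have := hN (vX a n x); move: IH; rewrite -/(vX a n) mulSn; lia.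
Qed.

Lemma iter_fix (T : Type) (f : T -> T) x n m : iter n f x = x -> iter (n * m) f x = x.
Proof.
by move=> h; elim: m => [|m IH]; rewrite ?muln0 // mulnS iterD IH.
Qed.
Lemma vX_fix a x n m : vX a n x = x -> vX a (n * m) x = x.
Proof. by rewrite !vXE; apply: iter_fix. Qed.
Arguments vV : simpl never.
Arguments vM : simpl never.

(** * Dynamics of a single element *)

(** The infinite pigeonhole principle: either the head of [l] recurs, or beyond some rank only the
    tail occurs. *)
Lemma pigeon (T : eqType) (l : seq T) (R : nat -> T -> Prop) :
  (forall m, exists n, (m <= n)%N /\ exists2 t, t \in l & R n t) ->
  exists2 t, t \in l & forall m, exists2 n, (m <= n)%N & R n t.
Proof.
elim: l => [|t0 l IH] h; first by have [n [_ []]] := h 0%N.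
have [h0|/existsNP[m0 hm0]] := pselect (forall m, exists2 n, (m <= n)%N & R n t0).
  by exists t0; rewrite ?mem_head.
case: IH => [m|t tl ht]; last by exists t => //; rewrite in_cons tl orbT.
have [n [hn [t]]] := h (maxn m m0); rewrite in_cons => /orP[/eqP ->|tl] hR.
  by case: hm0; exists n => //; lia.
by exists n; split; [lia|exists t].
Qed.

Fixpoint words (n : nat) : seq (seq bool) :=
  [::] :: (if n is m.+1 then [seq b :: s | b <- [:: true; false], s <- words m] else [::]).

Lemma mem_words n s : (size s <= n)%N -> s \in words n.
Proof.
elim: s n => [|b s IH] [|n] //= hs; rewrite in_cons /=.
have /IH hm := hs.
by rewrite mem_cat cats0; case: b; [rewrite map_f|rewrite orbC map_f].
Qed.

(** The monoid generated by [S]; it is a group as soon as [S] is closed under inverses. *)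
Inductive gen (S : vaut -> Prop) : vaut -> Prop :=
| gen_one : gen S v1
| gen_mul s h : S s -> gen S h -> gen S (vM s h).

(** A generator is affine on every cylinder of depth at least [N]. Hence, as long as the images of
    [u] stay deeper than [N], multiplying by one more generator keeps the product affine on [u]. *)
Lemma gen_dichotomy (S : vaut -> Prop) N u : (forall s, S s -> unif N s) ->
  (exists h v e, [/\ gen S h, aff h u v e & (size v <= N)%N]) \/
  (forall h, gen S h -> exists v e, aff h u v e /\ (N < size v)%N).
Proof.
move=> hS; have [h|hn] := pselect (exists h v e, [/\ gen S h, aff h u v e & (size v <= N)%N]).
  by left.
right=> h hg.
suff [v [e hv]] : exists v e, aff h u v e.
  exists v, e; split => //; rewrite ltnNge; apply/negP => hs; apply: hn.
  by exists h, v, e.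
elim: hg => [|s h' hs hg' [v [e hv]]].
  by exists u, false => w; rewrite flip0.
have [|w [e' hw]] := hS _ hs v.
  by rewrite leqNgt; apply/negP => hlt; apply: hn; exists h', v, e; split => //; apply: ltnW.
by exists w, (e' (+) e); apply: affM hv hw.
Qed.

Lemma gen_eq a h : gen (eq a) h -> exists j, h = vX a j.
Proof.
elim=> [|s h' <- _ [j ->]]; first by exists 0%N.
by exists j.+1.
Qed.

Lemma gen_vX a j : gen (eq a) (vX a j).
Proof. by elim: j => [|j IH]; [apply: gen_one|apply: gen_mul]. Qed.

Definition periodic (a : vaut) x := exists2 j, (0 < j)%N & vX a j x = x.
(** At a periodic point the return map has derivative [l ^ kz] up to sign, and [l < 1]: a zero [kz]
    is neutral, a negative one repels, a positive one attracts. Defining [att] through the inverse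
    lets every statement about repellers apply to attractors. *)
Definition neutral (a : vaut) x :=
  exists2 j, (0 < j)%N & vX a j x = x /\ kz (vX a j) x = 0.
Definition rep (a : vaut) x :=
  exists2 j, (0 < j)%N & vX a j x = x /\ kz (vX a j) x < 0.
Definition att (a : vaut) := rep (vV a).

Lemma attP a x : att a x <-> exists2 j, (0 < j)%N & vX a j x = x /\ 0 < kz (vX a j) x.
Proof.
split=> -[j j0 [hx hk]]; exists j => //.
  have hx' : vX a j x = x by rewrite -{1}hx vXVK'.
  split => //; have := kzV (vX a j) x; rewrite -vXV hx'; lia.
have hx' : vX (vV a) j x = x by rewrite -{1}hx vXVK.
split => //; have := kzV (vX a j) x; rewrite -vXV hx; lia.
Qed.

(** Both sides are the cocycle of the common period [i * j]. So the sign of [kz] is independent of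
    the period, and the three kinds of periodic points are disjoint. *)
Lemma kz_periods a x i j : vX a i x = x -> vX a j x = x ->
  kz (vX a i) x *+ j = kz (vX a j) x *+ i.
Proof. by move=> hi hj; rewrite -!kzXM // mulnC. Qed.

Lemma neutral_rep a x : neutral a x -> ~ rep a x.
Proof.
move=> [i i0 [hi ki]] [j j0 [hj kj]]; have := kz_periods hi hj; rewrite ki mul0rn; nia.
Qed.

Lemma neutral_att a x : neutral a x -> ~ att a x.
Proof.
move=> [i i0 [hi ki]] /attP[j j0 [hj kj]]; have := kz_periods hi hj; rewrite ki mul0rn; nia.
Qed.

Lemma rep_att a x : rep a x -> ~ att a x.
Proof.
move=> [i i0 [hi ki]] /attP[j j0 [hj kj]]; have := kz_periods hi hj; nia.
Qed.

Lemma neutral_periodic a x : neutral a x -> periodic a x.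
Proof. by move=> [j j0 []]; exists j. Qed.
Lemma rep_periodic a x : rep a x -> periodic a x.
Proof. by move=> [j j0 []]; exists j. Qed.

Lemma vXC a i j x : vX a i (vX a j x) = vX a j (vX a i x).
Proof. by rewrite -!vME -!vXD addnC. Qed.

Lemma kz_conj a i j x : vX a j x = x -> kz (vX a j) (vX a i x) = kz (vX a j) x.
Proof.
move=> hx; have := kzXD a i j x; rewrite addnC kzXD hx.
lia.
Qed.

Lemma periodic_X a i j x : vX a j (vX a i x) = vX a i x -> vX a j x = x.
Proof. by rewrite vXC; apply: vfun_inj. Qed.

Lemma neutral_X a i x : neutral a (vX a i x) <-> neutral a x.
Proof.
split=> -[j j0 [hx hk]]; exists j => //.
  by have hx' := periodic_X hx; rewrite -(kz_conj i hx').
by rewrite kz_conj // vXC hx.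
Qed.

Lemma rep_X a i x : rep a (vX a i x) -> rep a x.
Proof.
move=> [j j0 [hx hk]]; exists j => //.
by have hx' := periodic_X hx; rewrite -(kz_conj i hx').
Qed.

Lemma neutralV a x : neutral (vV a) x <-> neutral a x.
Proof.
suff H b : neutral b x -> neutral (vV b) x by split=> [/H|/H //]; rewrite vVK.
move=> [j j0 [hx hk]]; exists j => //.
have hx' : vX (vV b) j x = x by rewrite -{1}hx vXVK.
split => //; have := kzV (vX b j) x; rewrite -vXV hx hk; lia.
Qed.

Lemma aff_iter (b : vaut) W s e t : aff b W (W ++ s) e ->
  exists s' e', size s' = (t * size s)%N /\ aff (vX b t) W (W ++ s') e'.
Proof.
move=> h; elim: t => [|t [s' [e' [hs' h']]]].
  by exists [::], false; rewrite cats0; split => // w; rewrite flip0.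
exists (s ++ lflip e s'), (e (+) e'); split.
  by rewrite size_cat size_lflip hs' mulSn.
rewrite catA; apply: affM h' _; exact: aff_ext.
Qed.

(** Both points lie in the images of the cylinder of [W] under arbitrarily large powers of [b], and
    these images shrink to a point. *)
Lemma contract_eq (b : vaut) W s e x y : (0 < size s)%N -> aff b W (W ++ s) e ->
  (forall m, exists2 t, (m <= t)%N & exists2 x', incyl W x' & vX b t x' = x) ->
  (forall t, exists2 y', incyl W y' & vX b t y' = y) -> x = y.
Proof.
move=> s0 h hx hy; apply: stream_eqP => n.
have [t nt [x' hx' ex]] := hx n; have [y' hy' ey] := hy t.
have [s' [e' [hs' h']]] := aff_iter t h.
have /eqP h1 := aff_incyl h' hx'; have h2 := aff_incyl h' hy'.
rewrite ex in h1; rewrite ey in h2.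
apply: (@incyl_pre_le _ (size (W ++ s'))); last by rewrite h1.
by rewrite size_cat hs'; nia.
Qed.

(** The fixed point is [W] followed by [s] repeated forever. *)
Lemma contract_fixed (b : vaut) W s : (0 < size s)%N -> aff b W (W ++ s) false ->
  exists2 r, incyl W r & b r = r.
Proof.
move=> s0 h; pose w : stream := fun i => nth false s (i %% size s).
exists (app W w); first exact: incyl_app.
rewrite h flip0 app_cat; congr app; apply/funext => i; rewrite /app /w.
case: (ltnP i (size s)) => hi; first by rewrite [in RHS]modn_small //; apply: set_nth_default.
by rewrite nth_default // -{2}(subnK hi) modnDr.
Qed.

(* Infinitely many prefixes of [x] are sent to the same word [W], so some power
   of the inverse of [a] contracts the cylinder of [W]; the orbit of [x] must
   then meet the fixed point of this contraction. *)
Lemma rep_of_large_images a N x :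
  (forall n, (N <= n)%N -> exists j v e, aff (vX a j) (pre n x) v e /\ (size v <= N)%N) ->
  rep a x.
Proof.
move=> hN.
have [B hB] := kzX_bound a.
have [W [e hW]] : exists (W : seq bool) (e : bool), forall m, exists2 n, (m <= n)%N &
    exists j, aff (vX a j) (pre n x) W e.
  have [m|[W e] _ hW] := @pigeon _ [seq (v, e) | v <- words N, e <- [:: true; false]]
    (fun n t => exists j, aff (vX a j) (pre n x) t.1 t.2) _; last by exists W, e.
  have [j [v [e [h hs]]]] := hN (maxn m N) (leq_maxr _ _).
  exists (maxn m N); split; first exact: leq_maxl.
  exists (v, e); last by exists j.
  by apply/allpairsP; exists (v, e); split; rewrite ?mem_words //; case: e {h}.
have [n0 _ [j0 h0]] := hW 0%N.
pose z := vX a j0 x.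
have hz : incyl W z by apply: aff_incyl h0 (incyl_pre n0 x).
have key M : exists E s, [/\ (M <= E)%N, (M <= size s)%N, incyl (W ++ s) z & aff (vX a E) (W ++ s) W false].
  (* Shortening a prefix of this length to [W] makes [kz] smaller than [- (j0 + M) * B]. Each
     application of [a] lowers it by at most [B], so more than [j0 + M] of them are needed. *)
  have [n hn [j hj]] := hW (size W + (j0 + M) * B + n0 + M).+1.
  have lejj : (j0 + M < j)%N.
    have := kzE (incyl_pre n x) hj; have := hB j x; rewrite size_pre.
    case: (leqP j (j0 + M)) => // hle; have := leq_mul hle (leqnn B); lia.
  have [t ht] : exists t, pre n x = pre n0 x ++ t by apply: pre_cat_le; lia.
  exists (j - j0)%N, (lflip e t); split; first lia.
  - rewrite size_lflip; have := congr1 size ht; rewrite size_cat !size_pre; lia.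
  - apply: (aff_incyl (aff_ext t h0)); rewrite -ht; exact: incyl_pre.
  have -> : vX a (j - j0) = vM (vX a j) (vV (vX a j0)).
    apply: vaut_eq => y; have {1}-> : y = vX a j0 (vX (vV a) j0 y) by rewrite vXVK'.
    by rewrite -!vME -vXD subnK ?vXV // ltnW //; apply: leq_ltn_trans lejj; rewrite leq_addr.
  rewrite -(addbb e); apply: affM (affV (aff_ext t h0)) _.
  by rewrite -ht.
have [eps [s1 [eps0 s10 hs1 ha1]]] := key 1%N.
pose b := vX (vV a) eps.
have hb : aff b W (W ++ s1) false by rewrite /b vXV; apply: affV.
have [r rW rfix] := contract_fixed s10 hb.
(* Reduce the exponents [E] of [key] modulo [eps]. Some residue [q] recurs, so [vX a q z] lies in
   the images of [W] under arbitrarily large powers of [b], and equals [r]. *)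
have [|q _ hq] := @pigeon _ (iota 0 eps) (fun m q => exists2 t, (m <= t)%N &
   exists2 y, incyl W y & vX b t y = vX a q z) _.
  move=> m; have [E [s [hE hs hsz haE]]] := key (m * eps)%N.
  exists m; split => //; exists (E %% eps)%N.
    by rewrite mem_iota /= add0n ltn_pmod.
  exists (E %/ eps)%N; first by rewrite leq_divRL.
  exists (vX a E z); first exact: aff_incyl haE _.
  have -> : vX a E z = vX a (E %/ eps * eps) (vX a (E %% eps) z).
    by rewrite -vME -vXD -divn_eq.
  by rewrite /b -vXM [(eps * _)%N]mulnC vXVK.
have hqr : vX a q z = r.
  apply: (contract_eq s10 hb).
    by move=> m; have [n hn [t ht [y hy e1]]] := hq m; exists t; [lia|exists y].
  by move=> t; exists r => //; rewrite vXE; elim: t => //= t ->.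
have reps : vX a eps r = r.
  by rewrite -{1}rfix /b vXVK'.
have kr : kz (vX a eps) r < 0.
  have hr : incyl (W ++ s1) r by rewrite -rfix; apply: aff_incyl hb rW.
  rewrite (kzE hr ha1) size_cat; lia.
apply: (@rep_X _ (q + j0)); rewrite vXD vME -/z hqr.
by exists eps.
Qed.

Lemma gen_all_aff (a : vaut) x N : unif N a -> ~ rep a x ->
  exists n, forall j, exists v e, aff (vX a j) (pre n x) v e.
Proof.
move=> hN hx; apply: contrapT => hn; apply: hx.
apply: (@rep_of_large_images a N) => n _.
have [|[h [v [e [hg ha hs]]]]|hall] := @gen_dichotomy (eq a) N (pre n x).
- by move=> s <-.
- by have [j ej] := gen_eq hg; subst h; exists j, v, e.
- case: hn; exists n => j; have [v [e [h _]]] := hall _ (gen_vX a j).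
  by exists v, e.
Qed.

Lemma wandering_or_attracted a x : ~ neutral a x -> ~ rep a x ->
  exists u, [/\ incyl u x, forall j, exists v e, aff (vX a j) u v e &
    forall L, exists J, forall j v e, (J <= j)%N -> aff (vX a j) u v e -> (L <= size v)%N].
Proof.
move=> hT hR; have [N hN] := vunif a.
have [n hall] := gen_all_aff hN hR.
exists (pre n x); split => //; first exact: incyl_pre.
have [v hv] := choice hall; have {hv} [e hv] := choice hv.
suff H L : exists J, forall j, (J <= j)%N -> (L <= size (v j))%N.
  move=> L; have [J hJ] := H L; exists J => j v' e' hj h.
  by have [-> _] := aff_uniq h (hv j); apply: hJ.
have hvx i : incyl (v i) (vX a i x) by apply: aff_incyl (hv i) (incyl_pre n x).
have step i j : (i <= j)%N -> aff (vX a (j - i)) (v i) (v j) (e j (+) e i).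
  move=> hij; have -> : vX a (j - i) = vM (vX a j) (vV (vX a i)).
    apply: vaut_eq => y; have {1}-> : y = vX a i (vV (vX a i) y) by rewrite vEV.
    by rewrite -vME -vXD subnK.
  exact: affM (affV (hv i)) (hv j).
have [B hB] := kzX_bound a.
have [[i [j [s [hij hs]]]]|hno1] := pselect (exists i j s, (i < j)%N /\ v j = v i ++ s).
  have hst := step _ _ (ltnW hij); rewrite hs in hst.
  have eps0 : (0 < j - i)%N by rewrite subn_gt0.
  case: s => [|b s] in hs hst *.
    case: hT; apply/(@neutral_X a i); rewrite cats0 in hst.
    (* Doubling the exponent cancels a possible complementation. *)
    exists ((j - i) + (j - i))%N; first lia.
    have h2 : aff (vX a (j - i + (j - i))) (v i) (v i) false.
      by rewrite vXD -(addbb (e j (+) e i)); apply: affM.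
    split; last by rewrite (kzE (hvx i) h2) subrr.
    by have /incylP[w ->] := hvx i; rewrite h2 flip0.
  (* After [i] steps come [t] full rounds, each adding at least one digit, then [q] steps with
     [q < j - i], which lose at most [(j - i) * B] digits. *)
  exists (i + (j - i) * (L + (j - i) * B))%N => k hk.
  pose q := ((k - i) %% (j - i))%N; pose t := ((k - i) %/ (j - i))%N.
  have ek : k = (q + ((j - i) * t + i))%N.
    rewrite addnA [(q + _)%N]addnC mulnC -divn_eq subnK //; lia.
  have ht : (L + (j - i) * B <= t)%N.
    rewrite leq_divRL // mulnC; lia.
  have hq : (q <= j - i)%N by apply: ltnW; rewrite ltn_mod.
  have [s' [e' [hs' h']]] := aff_iter t hst.
  have h1 := affM (hv i) h'; rewrite -vXM -vXD in h1.
  have k1 := kzE (incyl_pre n x) h1; have k2 := kzE (incyl_pre n x) (hv k).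
  move: k2; rewrite {1}ek kzXD k1.
  have := hB q (vX a ((j - i) * t + i) x); have := leq_mul hq (leqnn B).
  rewrite size_cat hs' /= mulnS; lia.
have [[i [j [s [hij hs s0]]]]|hno2] := pselect (exists i j s, [/\ (i < j)%N, v i = v j ++ s & (0 < size s)%N]).
  have hst := step _ _ (ltnW hij); rewrite hs in hst.
  suff H t : exists w e', aff (vX a ((j - i) * t)) (v j) w e' /\ (size w + t * size s = size (v j))%N.
    by have [w [e' [_]]] := H (size (v j)).+1; nia.
  elim: t => [|t [w [e' [hw1 hw2]]]].
    by exists (v j), false; rewrite muln0 addn0; split => // w; rewrite flip0.
  have h3 := affM hst hw1; rewrite -vXD addnC -mulnS in h3.
  have := step j (j + (j - i) * t.+1)%N (leq_addr _ _); rewrite addKn => h4.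
  have [h5 _] := aff_uniq h3 (aff_ext s h4).
  exists (v (j + (j - i) * t.+1)%N), (e (j + (j - i) * t.+1)%N (+) e j).
  split => //; have := congr1 size h5; rewrite size_cat size_lflip; lia.
apply: contrapT => hn.
have [m|W _ hW] := @pigeon _ (words L) (fun m w => v m = w).
  have /existsNP[j /not_implyP[hj hL]] : ~ forall j, (m <= j)%N -> (L <= size (v j))%N.
    by move=> h; apply: hn; exists m.
  exists j; split => //; exists (v j) => //; apply: mem_words.
  by apply: ltnW; rewrite ltnNge; apply/negP.
have [i _ hi] := hW 0%N; have [j hj ej] := hW i.+1.
by apply: hno1; exists i, j, [::]; rewrite cats0 hi ej.
Qed.

(** The inverse of the return map contracts a cylinder around [x], and a periodic point in that
    cylinder is fixed by arbitrarily large powers of this contraction. *)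
Lemma rep_isolated a x : rep a x ->
  exists2 u, incyl u x & forall y, incyl u y -> periodic a y -> y = x.
Proof.
move=> [j j0 [hx hk]]; have [u [hu [v [e h]]]] := local_aff (vX a j) x.
have hv := aff_incyl h hu; rewrite hx in hv.
have := kzE hu h; move=> ek.
have [|s hs] := incyl_cat hv hu; first lia.
have s0 : (0 < size s)%N by have := congr1 size hs; rewrite size_cat; lia.
exists v => // y hy [m m0 hm].
subst u; have hb := affV h.
have fixV z k : vX a k z = z -> vX (vV a) k z = z by move=> {1}<-; rewrite vXVK.
rewrite -vXV in hb.
apply: (contract_eq s0 hb) => [t|t].
  exists (m * t)%N; first by rewrite leq_pmull.
  exists y => //; rewrite -vXM; apply: fixV; rewrite mulnCA; apply: vX_fix; exact: hm.
by exists x => //; rewrite -vXM; apply: fixV; apply: vX_fix; exact: hx.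
Qed.

(** The return map sends a cylinder around [x] affinely to itself. Complementing the tail would
    leave no fixed point, so it is the identity there. *)
Lemma neutral_open a x : neutral a x -> exists u j, [/\ incyl u x, (0 < j)%N,
  aff (vX a j) u u false & forall y, incyl u y -> vX a j y = y /\ neutral a y].
Proof.
move=> [j j0 [hx hk]]; have [u [hu [v [e h]]]] := local_aff (vX a j) x.
have hv := aff_incyl h hu; rewrite hx in hv.
have := kzE hu h; rewrite hk => hs.
have euv : u = v by apply: (incyl_size hu hv); lia.
subst v; have [w ew] := incylP _ _ hu.
have ee : e = false.
  move: hx; rewrite ew h => /app_inj /(congr1 (fun f => f 0%N)).
  by rewrite /flip; case: (e); case: (w 0%N).
subst e; exists u, j; split => // y hy.
have hy' : vX a j y = y by have [z ->] := incylP _ _ hy; rewrite h flip0.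
by split => //; exists j => //; split => //; rewrite (kzE hy h) subrr.
Qed.

(** Repelling points are isolated among periodic points. Near the other points [kz] becomes positive
    for all large powers, whereas at a neutral point it vanishes at every multiple of the period. *)
Lemma neutral_closed a x : ~ neutral a x ->
  exists2 u, incyl u x & forall y, incyl u y -> ~ neutral a y.
Proof.
move=> hT; have [hR|hR] := pselect (rep a x).
  have [u hu h] := rep_isolated hR; exists u => // y hy hn.
  by apply: hT; rewrite -(h _ hy (neutral_periodic hn)).
have [u [hu hall hL]] := wandering_or_attracted hT hR.
exists u => // y hy [j j0 [hj kj]].
have [J hJ] := hL (size u).+1.
have [v [e h]] := hall (j * J)%N.
have := hJ _ _ _ (leq_pmull _ j0) h; have := kzE hy h.
rewrite kzXM // kj mul0rn; lia.
Qed.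

Lemma rep_finite a : exists l : seq stream, forall x, rep a x -> x \in l.
Proof.
suff [l hl] : exists l : seq stream, forall x, incyl [::] x -> rep a x -> x \in l.
  by exists l => x; apply: hl; apply: incyl_nil.
elim/cantor_bar_cover: [::] => [u s [l hl]|u [l hl] [l' hl']|x].
- by exists l => x /incyl_catl; apply: hl.
- by exists (l ++ l') => x /incyl_rcons[/hl h|/hl' h] /h; rewrite mem_cat => ->; rewrite ?orbT.
- have [hR|hR] := pselect (rep a x).
    have [u hu h] := rep_isolated hR; exists u => //; exists [:: x] => y hy /rep_periodic hy'.
    by rewrite (h _ hy hy') mem_head.
  have [hT|hT] := pselect (neutral a x).
    have [u [j [hu j0 _ h]]] := neutral_open hT; exists u => //; exists [::] => y hy hr.
    by have [_ hn] := h _ hy; case: (neutral_rep hn hr).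
  have [u [hu hall hL]] := wandering_or_attracted hT hR.
  exists u => //; exists [::] => y hy [j j0 [hj kj]].
  have [J hJ] := hL (size u); have [v [e h]] := hall (j * J.+1)%N.
  have := hJ _ _ _ (leq_trans (leqnSn J) (leq_pmull _ j0)) h; have := kzE hy h.
  by rewrite kzXM //; nia.
Qed.

Definition nearby (m : nat) (P : stream -> Prop) x := exists2 p, P p & incyl (pre m p) x.

(** By compactness: a repeller or a neutral point has a cylinder on which the hypotheses fail, and
    near any other point the image words grow without bound. *)
Lemma kz_large a m (L : nat) : exists J, forall j x, (J <= j)%N ->
  ~ neutral a x -> ~ nearby m (rep a) x -> L%:Z <= kz (vX a j) x.
Proof.
suff [J hJ] : exists J, forall x, incyl [::] x -> forall j, (J <= j)%N ->
  ~ neutral a x -> ~ nearby m (rep a) x -> L%:Z <= kz (vX a j) x.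
  by exists J => j x; apply: hJ; apply: incyl_nil.
elim/cantor_bar_cover: [::] => [u s [J hJ]|u [J hJ] [J' hJ']|x].
- by exists J => x /incyl_catl; apply: hJ.
- exists (maxn J J') => x /incyl_rcons[/hJ h|/hJ' h] j hj; apply: h; lia.
- have [hR|hR] := pselect (rep a x).
    exists (pre m x); first exact: incyl_pre.
    by exists 0%N => y hy j _ _ []; exists x.
  have [hT|hT] := pselect (neutral a x).
    have [u [j [hu j0 _ h]]] := neutral_open hT; exists u => //; exists 0%N => y hy i _ [].
    by have [] := h _ hy.
  have [u [hu hall hL]] := wandering_or_attracted hT hR; exists u => //.
  have [J hJ] := hL (size u + L)%N; exists J => y hy j hj _ _.
  have [v [e h]] := hall j; rewrite (kzE hy h).
  have := hJ _ _ _ hj h; lia.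
Qed.

(** Otherwise [kz_large] would apply to [a] at [x] and to its inverse at [vX a j x], making two
    opposite integers both positive. *)
Lemma attracted a m : exists J, forall j x, (J <= j)%N ->
  ~ neutral a x -> ~ nearby m (rep a) x -> nearby m (att a) (vX a j x).
Proof.
have [J hJ] := kz_large a m 1; have [J' hJ'] := kz_large (vV a) m 1.
exists (maxn J J') => j x hj hT hR; apply: contrapT => hA.
have h1 : 1%:Z <= kz (vX a j) x by apply: hJ => //; lia.
have h2 : 1%:Z <= kz (vX (vV a) j) (vX a j x).
  by apply: hJ' => //; [lia|rewrite neutralV neutral_X].
rewrite vXV kzV in h2; lia.
Qed.

(** * Combining neutral sets *)

Lemma seq_uniform (T : eqType) (l : seq T) (Q : nat -> T -> Prop) :
  (forall n m t, (n <= m)%N -> Q n t -> Q m t) ->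
  (forall t, t \in l -> exists n, Q n t) ->
  exists n, forall m t, (n <= m)%N -> t \in l -> Q m t.
Proof.
move=> hQ; elim: l => [|t0 l IH] h; first by exists 0%N.
have [|n hn] := IH; first by move=> t tl; apply: h; rewrite in_cons tl orbT.
have [n0 hn0] := h t0 (mem_head _ _).
exists (maxn n n0) => m t hm; rewrite in_cons => /orP[/eqP ->|tl].
  by apply: hQ hn0; lia.
by apply: hn => //; lia.
Qed.

Lemma nearby_le m n P x : (m <= n)%N -> nearby n P x -> nearby m P x.
Proof. by move=> h [p hp hx]; exists p => //; apply: incyl_pre_le h hx. Qed.

Lemma incyl_pre_trans m x y z : incyl (pre m x) z -> incyl (pre m y) z -> incyl (pre m x) y.
Proof. by rewrite /incyl !size_pre => /eqP <- /eqP ->. Qed.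

Lemma not_nearby (P : stream -> Prop) (l : seq stream) y : (forall x, P x -> x \in l) -> ~ P y ->
  exists m, ~ nearby m P y.
Proof.
move=> hl hy.
have [||m hm] := @seq_uniform _ l (fun n p => P p -> ~~ incyl (pre n p) y).
- by move=> n m p hnm h /h; apply: contra; apply: incyl_pre_le.
- move=> p _; have [hp|hp] := pselect (P p); last by exists 0%N.
  by have [n hn] := stream_neq (fun e : p = y => hy (eq_ind p P hp y e)); exists n.
by exists m => -[p hp]; apply/negP; apply: hm (hl _ hp) hp.
Qed.

Lemma vaut_continuous (c : vaut) x u : incyl u (c x) ->
  exists n, forall y, incyl (pre n x) y -> incyl u (c y).
Proof.
move=> hu; have [w [hw [v [e h]]]] := local_aff c x.
exists (size w + size u)%N => y hy.
have [s hs] : exists s, pre (size w + size u) x = w ++ s.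
  by apply: incyl_cat hw (incyl_pre _ _) _; rewrite size_pre leq_addr.
have h1 := aff_ext s h; have hx := incyl_pre (size w + size u) x.
rewrite hs in hy hx; have hcx := aff_incyl h1 hx; have hcy := aff_incyl h1 hy.
have [|t ht] := incyl_cat hu hcx.
  have := congr1 size hs; rewrite size_pre !size_cat size_lflip; lia.
by rewrite ht in hcy; apply: incyl_catl hcy.
Qed.

Lemma neutral_vX a q x : (0 < q)%N -> neutral (vX a q) x <-> neutral a x.
Proof.
move=> q0; split=> -[j j0 [hj kj]].
  by exists (q * j)%N; [rewrite muln_gt0 q0|rewrite vXM].
exists j => //; rewrite -vXM mulnC; split; first exact: vX_fix.
by rewrite kzXM // kj mul0rn.
Qed.

Lemma neutral_kz a x n : neutral a x -> vX a n x = x -> kz (vX a n) x = 0.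
Proof.
by move=> [j j0 [hj kj]] hx; have := kz_periods hj hx; rewrite kj mul0rn; nia.
Qed.

Lemma neutral_period a : exists2 q, (0 < q)%N & forall x, neutral a x -> vX a q x = x.
Proof.
suff [q q0 hq] : exists2 q, (0 < q)%N & forall x, incyl [::] x -> neutral a x -> vX a q x = x.
  by exists q => // x; apply: hq; apply: incyl_nil.
elim/cantor_bar_cover: [::] => [u s [q q0 hq]|u [q q0 hq] [r r0 hr]|x].
- by exists q => // x /incyl_catl; apply: hq.
- exists (q * r)%N; first by rewrite muln_gt0 q0.
  move=> x /incyl_rcons[hx /hq - /(_ hx)|hx /hr - /(_ hx)]; first exact: vX_fix.
  by rewrite mulnC; apply: vX_fix.
- have [hT|/neutral_closed[u hu h]] := pselect (neutral a x).
    by have [u [j [hu j0 _ h]]] := neutral_open hT; exists u => //; exists j => // y /h [].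
  by exists u => //; exists 1%N => // y /h.
Qed.

(** The neutral set is clopen, so by compactness membership is decided by finitely many digits. *)
Lemma neutral_uniform a : exists D, forall u, (D <= size u)%N ->
  (forall x, incyl u x -> neutral a x) \/ (forall x, incyl u x -> ~ neutral a x).
Proof.
suff [D hD] : exists D, forall s, (D <= size s)%N ->
  (forall x, incyl ([::] ++ s) x -> neutral a x) \/ (forall x, incyl ([::] ++ s) x -> ~ neutral a x).
  by exists D.
elim/cantor_bar_cover: [::] => [u s [D hD]|u [D hD] [D' hD']|x].
- by exists D => t ht; rewrite -catA; apply: hD; rewrite size_cat; lia.
- exists (maxn D D').+1 => -[|[] s] //= hs; rewrite -cat_rcons; [apply: hD'|apply: hD]; lia.
- have [hT|/neutral_closed[u hu h]] := pselect (neutral a x).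
    have [u [j [hu j0 _ h]]] := neutral_open hT; exists u => //; exists 0%N => s _; left.
    by move=> y /incyl_catl/h [].
  by exists u => //; exists 0%N => s _; right => y /incyl_catl/h.
Qed.

Lemma neutral_stable a (c : vaut) x : exists n, forall y, incyl (pre n x) y ->
  neutral a (c y) <-> neutral a (c x).
Proof.
have [D hD] := neutral_uniform a.
have [n hn] := vaut_continuous (incyl_pre D (c x)).
exists n => y /hn hy; have [|h|h] := hD (pre D (c x)); first by rewrite size_pre.
  by split=> _; apply: h => //; apply: incyl_pre.
by split=> hc; [have := h _ hy|have := h _ (incyl_pre _ _)].
Qed.

Lemma neutral_stable_iter a b x S : exists n, forall y i, incyl (pre n x) y -> (i < S)%N ->
  neutral a (vX b i y) <-> neutral a (vX b i x).
Proof.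
elim: S => [|S [n hn]]; first by exists 0%N.
have [m hm] := neutral_stable a (vX b S) x.
exists (maxn n m) => y i hy; rewrite ltnS leq_eqVlt => /orP[/eqP ->|hi].
  by apply: hm; apply: incyl_pre_le hy; lia.
by apply: hn => //; apply: incyl_pre_le hy; lia.
Qed.

Lemma vXS a n x : vX a n.+1 x = a (vX a n x). Proof. by []. Qed.
Lemma kzXS a n x : kz (vX a n.+1) x = kz a (vX a n x) + kz (vX a n) x.
Proof. exact: kzM. Qed.

(* [vX b s x] is the first return of the orbit of [x] to the active part of [a],
   the complement of its neutral set. *)
Definition excursion (a b : vaut) (p : nat) (B : nat) (x : stream) :=
  forall s, (0 < s)%N -> (forall i, (0 < i < s)%N -> neutral a (vX b i x)) ->
  ~ neutral a (vX b s x) ->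
  ~ nearby p (rep a) (vX b s x) /\ - B%:Z <= kz (vX b s) x.

(** If the orbit of [al] under [b] meets the active part of [a], the first such time is shared by
    all nearby points, and continuity concludes. If not, [al] is not periodic under [b], so the
    images of a cylinder around it become deeper than the depth deciding neutrality; nearby orbits
    then never return and there is nothing to prove. *)
Lemma excursion_at a b al : att a al -> (forall s, (0 < s)%N -> ~ rep a (vX b s al)) ->
  exists p, forall x, incyl (pre p al) x -> excursion a b p p x.
Proof.
move=> hal hC; have [N hN] := kzX_bound b; have [l hl] := rep_finite a.
have [hex|hnex] := pselect (exists s, (0 < s)%N && `[< ~ neutral a (vX b s al) >]).
  have {hex} [s /andP[s0 /asboolP hs] hmin] := ex_minnP hex.
  have [n hn] := neutral_stable_iter a b al s.+1.
  have [m hm] := not_nearby hl (hC s s0).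
  have [k hk] := vaut_continuous (incyl_pre m (vX b s al)).
  (* Depth [n] fixes the time of first return, [m] and [k] keep the return point away from the
     repellers, and [s * N] bounds the expansion in [s] steps. *)
  exists (n + m + k + s * N)%N => x hx t t0 hit ht.
  have hxn : incyl (pre n al) x by apply: incyl_pre_le hx; lia.
  have hxk : incyl (pre k al) x by apply: incyl_pre_le hx; lia.
  have ets : t = s.
    apply/eqP; rewrite eqn_leq; apply/andP; split.
      by rewrite leqNgt; apply/negP => hlt; apply: hs; apply/(hn x s hxn (ltnSn s)); apply: hit; rewrite s0.
    rewrite leqNgt; apply/negP => hlt.
    have : neutral a (vX b t al).
      apply: contrapT => h; have := hmin t; rewrite t0 /= asboolT // => /(_ isT); lia.
    by move/(hn x t hxn (ltnW hlt)).
  subst t; split; last by have := hN s x; lia.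
  move=> /(nearby_le (_ : (m <= _)%N)) h; apply: hm.
  have [|q hq hqx] := h; first lia.
  by exists q => //; apply: incyl_pre_trans hqx (hk _ hxk).
have hnb s : (0 < s)%N -> neutral a (vX b s al).
  by move=> s0; apply: contrapT => h; apply: hnex; exists s; rewrite s0 asboolT.
have hTal : ~ neutral a al by move=> /neutral_att.
have hper : ~ periodic b al by move=> [j j0 hj]; apply: hTal; rewrite -hj; apply: hnb.
have [||u [hu hall hL]] := @wandering_or_attracted b al.
- by move=> /neutral_periodic.
- by move=> /rep_periodic.
have [D hD] := neutral_uniform a; have [J hJ] := hL D.
have [n hn] := neutral_stable_iter a b al J.
exists (n + size u)%N => x hx s s0 _ []; case: (ltnP s J) => hs.
  by apply/(hn x s) => //; [apply: incyl_pre_le hx; lia|apply: hnb].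
have hux : incyl u x.
  by rewrite -(eqP hu); apply: incyl_pre_le hx; lia.
have [v [e h]] := hall s; have [|hv|hv] := hD v; first exact: hJ hs h.
  by apply: hv; apply: aff_incyl h hux.
by case: (hv (vX b s al)); [apply: aff_incyl h hu|apply: hnb].
Qed.

Lemma excursion_le a b p p' B B' x : (p <= p')%N -> (B <= B')%N ->
  excursion a b p B x -> excursion a b p' B' x.
Proof.
move=> hp hB h s s0 hi hs; have [h1 h2] := h s s0 hi hs; split; last lia.
by move=> /(nearby_le hp).
Qed.

Lemma excursion_uniform a b :
  (forall al s, att a al -> (0 < s)%N -> ~ rep a (vX b s al)) ->
  exists p, forall q x, (p <= q)%N -> nearby q (att a) x -> excursion a b q p x.
Proof.
move=> hC; have [l hl] := rep_finite (vV a).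
have [||p hp] := @seq_uniform _ l (fun p al => att a al ->
   forall x, incyl (pre p al) x -> excursion a b p p x).
- move=> n m al hnm h /h {}h x hx; apply: excursion_le (hnm) (hnm) (h _ _).
  exact: incyl_pre_le hx.
- move=> al _; have [hal|] := pselect (att a al); last by exists 0%N.
  by have [|p hp] := @excursion_at a b al hal; [move=> s; apply: hC|exists p].
exists p => q x hq [al hal hx]; apply: excursion_le (hq) (leqnn p) _.
apply: (hp p al (leqnn p) (hl _ hal) hal); exact: incyl_pre_le hx.
Qed.

(* Each visit to the active part of [a] contracts more than the excursion that
   precedes it can expand, so [kz] is unbounded along the orbit of [z]. *)
Lemma excursion_contradiction a b n p B z :
  (forall y, ~ neutral a y -> ~ nearby p (rep a) y ->
     nearby p (att a) (vX a n y) /\ B%:Z + 1 <= kz (vX a n) y) ->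
  (forall y, nearby p (att a) y -> excursion a b p B y) ->
  (forall y, neutral a y -> vX a n y = y) ->
  nearby p (att a) z -> ~ neutral a z -> ~ neutral (vM (vX a n) b) z.
Proof.
move=> h1 h2 h3 hz hzT; set c := vM _ b => -[M M0 [hM kM]].
have [N hN] := kzX_bound c; have cE y : c y = vX a n (b y) by [].
suff H (t : nat) : exists j, [/\ nearby p (att a) (vX c j z), ~ neutral a (vX c j z) & t%:Z <= kz (vX c j) z].
  (* Full periods of length [M] contribute nothing to [kz], and the fewer than [M] remaining steps
     contribute at most [M * N]. *)
  have [j [_ _ hj]] := H (M * N).+1.
  have ej := divn_eq j M; move: hj; rewrite {1}ej addnC kzXD [X in _ + X](_ : _ = 0); last first.
    by rewrite mulnC kzXM // kM mul0rn.
  have := hN (j %% M)%N (vX c (j %/ M * M) z); have := leq_mul (ltnW (ltn_pmod j M0)) (leqnn N); lia.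
elim: t => [|t [j [hja hjT hjk]]]; first by exists 0%N; rewrite kz1.
set z1 := vX c j z in hja hjT *.
have hM1 : vX c M z1 = z1 by rewrite /z1 vXC hM.
have hex : exists s, `[< ~ neutral a (b (vX c s z1)) >].
  (* The orbit is back at the active point [z1] after [M] steps, and powers of [a] preserve the
     active part. *)
  exists M.-1; apply/asboolP => h; apply: hjT.
  by rewrite -hM1 -(prednK M0) vXS cE; apply/neutral_X.
have [s /asboolP hs hmin] := ex_minnP hex.
have hit i : (i < s)%N -> neutral a (b (vX c i z1)).
  by move=> hi; apply: contrapT => h; have := hmin i; rewrite asboolT // => /(_ isT); lia.
(* Before the first return, the factor [vX a n] meets only neutral points, where it is the identity
   with zero cocycle. *)
have hi i : (i <= s)%N -> vX c i z1 = vX b i z1 /\ kz (vX c i) z1 = kz (vX b i) z1.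
  elim: i => [//|i IH] hi; have [e1 e2] := IH (ltnW hi).
  have hn := hit _ hi; rewrite !vXS cE (h3 _ hn) e1; split => //.
  by rewrite !kzXS /c kzM (neutral_kz hn (h3 _ hn)) add0r e2 e1.
have [e1 e2] := hi s (leqnn s).
have hs' : ~ neutral a (vX b s.+1 z1) by rewrite vXS -e1.
have [|h4 h5] := h2 _ hja s.+1 (ltn0Sn s) _ hs'.
  by case=> // i /andP[_]; rewrite ltnS => hi'; rewrite vXS; have [<- _] := hi i (ltnW hi'); apply: hit.
have [h6 h7] := h1 _ hs' h4.
have ez : vX c (s.+1 + j) z = vX a n (vX b s.+1 z1) by rewrite vXD vME -/z1 !vXS cE e1.
exists (s.+1 + j)%N; rewrite ez; split => //; first by rewrite neutral_X.
rewrite kzXD -/z1 kzXS {1}/c kzM e1 e2 -vXS.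
by rewrite kzXS in h5; lia.
Qed.

Lemma neutral_conj h a x : neutral a x -> neutral (vM h (vM a (vV h))) (h x).
Proof.
move=> [j j0 [hx kx]].
have e n : vX (vM h (vM a (vV h))) n = vM h (vM (vX a n) (vV h)).
  elim: n => [|n IH]; apply: vaut_eq => y; first by rewrite -{1}(vEV h y).
  by rewrite vXS IH !vME vVE.
exists j => //; rewrite e !vME vVE hx; split => //.
by rewrite !kzM !vME !vVE hx kzV kx; lia.
Qed.

(** An orbit that is not periodic visits each point at most once. *)
Lemma orbit_avoids b (al : stream) (l : seq stream) : ~ periodic b al ->
  exists M, forall j, (M <= j)%N -> vX b j al \notin l.
Proof.
move=> hal; elim: l => [|rh l [M hM]]; first by exists 0%N.
have [[j0 hj0]|hno] := pselect (exists j, vX b j al = rh); last first.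
  exists M => j hj; rewrite in_cons negb_or hM // andbT.
  by apply/eqP => h; apply: hno; exists j.
exists (maxn M j0.+1) => j hj; rewrite in_cons negb_or hM ?andbT; last lia.
apply/eqP => h; apply: hal; exists (j - j0)%N; first lia.
apply: (@vfun_inj (vX b j0)); rewrite -vME -vXD subnKC ?h ?hj0 //; lia.
Qed.

(** The property passes to multiples of [m], so the finitely many attractors are treated one at a
    time. For one that is periodic under [b] take a period, since an attractor is no repeller; for
    another, take an exponent beyond its last visit to a repeller. *)
Lemma power_avoids a b : exists2 m, (0 < m)%N &
  forall al s, att a al -> (0 < s)%N -> ~ rep a (vX (vX b m) s al).
Proof.
have [l hl] := rep_finite a; have [l' hl'] := rep_finite (vV a).
suff [m m0 hm] : exists2 m, (0 < m)%N &
    forall al s, al \in l' -> att a al -> (0 < s)%N -> ~ rep a (vX (vX b m) s al).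
  by exists m => // al s hal; apply: hm => //; apply: hl'.
elim: l' {hl'} => [|al0 l' [m m0 hm]]; first by exists 1%N.
suff [k k0 hk] : exists2 k, (0 < k)%N & forall s, att a al0 -> (0 < s)%N -> ~ rep a (vX (vX b k) s al0).
  exists (m * k)%N; first by rewrite muln_gt0 m0.
  move=> al s; rewrite in_cons => /orP[/eqP -> hal s0|hl0 hal s0].
    by rewrite [(m * k)%N]mulnC -vXM -mulnA vXM; apply: hk => //; rewrite muln_gt0 m0.
  by rewrite -vXM -mulnA vXM; apply: hm => //; rewrite muln_gt0 k0.
have [[p p0 hp]|hper] := pselect (periodic b al0).
  exists p => // s hal s0; rewrite -vXM vX_fix // => hr; exact: (rep_att hr hal).
have [M hM] := orbit_avoids l hper.
exists M.+1 => // s _ s0 /hl; apply/negP; rewrite -vXM; apply: hM.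
by apply: leq_trans (leqnSn M) (leq_pmulr _ s0).
Qed.

(* The exponents are chosen with [m] so large that [b ^ m] never sends an
   attractor of [a] to a repeller of [a], and then [n] much larger than [m]. *)
Lemma neutral_combine a b : exists n m, forall x,
  neutral (vM (vX a n) (vX b m)) x -> neutral a x /\ neutral b x.
Proof.
have [q q0 hq] := neutral_period a; pose a1 := vX a q.
have na x : neutral a1 x <-> neutral a x by apply: neutral_vX.
have fa x n : neutral a1 x -> vX a1 n x = x.
  by move=> /na/hq h; rewrite -vXM vX_fix.
have [m m0 hm] := power_avoids a1 b; pose b1 := vX b m.
have nb x : neutral b1 x <-> neutral b x by apply: neutral_vX.
have [p1 hp1] := excursion_uniform hm.
(* Inversion exchanges attractors and repellers, so the same power of [b] serves for the
   inverses. *)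
have [|p2 hp2] := @excursion_uniform (vV a1) (vV b1).
  rewrite /att vVK => al s hal s0 hr.
  apply: (hm (vX (vV b1) s al) s hr s0); by rewrite vXVK'.
pose p := maxn p1 p2.
have [J1 hJ1] := attracted a1 p; have [J2 hJ2] := attracted (vV a1) p.
have [J3 hJ3] := kz_large a1 p p1.+1; have [J4 hJ4] := kz_large (vV a1) p p2.+1.
pose n := (J1 + J2 + J3 + J4)%N.
exists (q * n)%N, m => x; rewrite vXM -/a1 -/b1 -na -nb; set c := vM _ _ => hc.
have cE y : c y = vX a1 n (b1 y) by [].
have [M M0 [hM kM]] := hc.
have [hall|/existsNP[i hi]] := pselect (forall i, neutral a1 (b1 (vX c i x))).
  have hi i : vX c i x = vX b1 i x /\ kz (vX c i) x = kz (vX b1 i) x.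
    elim: i => [//|i [e1 e2]].
    have hn := hall i; rewrite !vXS cE (fa _ _ hn) e1; split => //.
    by rewrite !kzXS /c kzM (neutral_kz hn (fa _ _ hn)) add0r e2 e1.
  split; last by have [e1 e2] := hi M; exists M => //; rewrite -e1 -e2.
  by rewrite -hM -(prednK M0) vXS cE; apply/neutral_X.
exfalso; pose z := vX c i.+1 x.
have hz : ~ neutral a1 z by rewrite /z vXS cE neutral_X.
have hcz : neutral c z by apply/neutral_X.
have [hzA|hzA] := pselect (nearby p (att a1) z).
  apply: (@excursion_contradiction a1 b1 n p p1 z) => // y.
  - move=> hy hyR; split; first by apply: hJ1 => //; rewrite /n; lia.
    by have := hJ3 n y _ hy hyR; rewrite /n; lia.
  - by apply: hp1; rewrite /p; lia.
  - exact: fa.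
(* When [z] is near no attractor, [w] is near a repeller. The argument is then run backwards on
   [vM (vX (vV a1) n) (vV b1)], the conjugate of [vV c] by [vX (vV a1) n]. *)
pose w := vX (vV a1) n z.
have hw : ~ neutral (vV a1) w by rewrite neutral_X neutralV.
have hwA : nearby p (att (vV a1)) w.
  by apply: hJ2; rewrite ?neutralV // /n; lia.
apply: (@excursion_contradiction (vV a1) (vV b1) n p p2 w) => // [y hy hyR|y|y|].
- split; first by apply: hJ2 => //; rewrite /n; lia.
  by have := hJ4 n y _ hy hyR; rewrite /n; lia.
- by apply: hp2; rewrite /p; lia.
- by move=> /neutralV h; rewrite vXV -{1}(fa y n h) vVE.
have /(neutral_conj (vX (vV a1) n)) := (neutralV c z).2 hcz.
suff -> : vM (vX (vV a1) n) (vM (vV c) (vV (vX (vV a1) n))) = vM (vX (vV a1) n) (vV b1) by [].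
apply: vaut_eq => y; rewrite !vME; congr (vX _ _ _); apply: (@vfun_inj c).
by rewrite vEV cE vEV vXV vVK.
Qed.

(** * The alternative for groups of prefix replacement maps *)

Lemma vMA a b c : vM a (vM b c) = vM (vM a b) c. Proof. exact: vaut_eq. Qed.
Lemma v1M a : vM v1 a = a. Proof. exact: vaut_eq. Qed.
Lemma vM1 a : vM a v1 = a. Proof. exact: vaut_eq. Qed.

Lemma genM S a b : gen S a -> gen S b -> gen S (vM a b).
Proof.
move=> ha hb; elim: ha => [|s h hs _ IH]; first by rewrite v1M.
by rewrite -vMA; apply: gen_mul.
Qed.

Lemma gen_incl (S : vaut -> Prop) s : S s -> gen S s.
Proof. by move=> hs; rewrite -[s]vM1; apply: gen_mul => //; apply: gen_one. Qed.

Lemma genV (S : vaut -> Prop) a : (forall s, S s -> S (vV s)) -> gen S a -> gen S (vV a).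
Proof.
move=> hS; elim=> [|s h hs hg IH].
  by rewrite (_ : vV v1 = v1); [apply: gen_one|apply: vaut_eq].
rewrite (_ : vV _ = vM (vV h) (vV s)); last exact: vaut_eq.
by apply: genM => //; apply/gen_incl/hS.
Qed.

Lemma genX S a n : gen S a -> gen S (vX a n).
Proof. by move=> ha; elim: n => [|n IH]; [apply: gen_one|apply: genM]. Qed.

Section FiniteOrbit.
Variables (S : vaut -> Prop) (N : nat).
Hypothesis unifS : forall s, S s -> unif N s.
Hypothesis symS : forall s, S s -> S (vV s).

Let F x := forall h, gen S h -> neutral h x.

(** Otherwise two prefixes of [x] of different lengths are sent to the same word with the same [e].
    Combining the two maps gives a group element that contracts a cylinder around [x], so [x] is not
    neutral for it. *)
Let F_all_aff x : F x -> exists n, forall h, gen S h -> exists v e, aff h (pre n x) v e.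
Proof.
move=> hx; apply: contrapT => hn.
have hN n : exists h v e, [/\ gen S h, aff h (pre n x) v e & (size v <= N)%N].
  have [//|hall] := gen_dichotomy (pre n x) unifS; case: hn; exists n => h /hall[v [e []]].
  by exists v, e.
have [W [e hW]] : exists (W : seq bool) (e : bool), forall m, exists2 n, (m <= n)%N &
    exists2 h, gen S h & aff h (pre n x) W e.
  have [m|[W e] _ hW] := @pigeon _ [seq (v, e) | v <- words N, e <- [:: true; false]]
    (fun n t => exists2 h, gen S h & aff h (pre n x) t.1 t.2) _; last by exists W, e.
  have [h [v [e [hg ha hs]]]] := hN m.
  exists m; split => //; exists (v, e); last by exists h.
  by apply/allpairsP; exists (v, e); split; rewrite ?mem_words //; case: e {ha}.
have [n1 _ [h1 g1 a1]] := hW 0%N; have [n2 hn2 [h2 g2 a2]] := hW n1.+1.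
have [s hs] := pre_cat_le x (ltnW hn2).
have s0 : (0 < size s)%N by have := congr1 size hs; rewrite size_cat !size_pre; lia.
have ha : aff (vM (vV h2) h1) (pre n1 x) (pre n1 x ++ s) false.
  by rewrite -(addbb e) -hs; apply: affM a1 (affV a2).
have [|j j0 [_ hk]] := hx (vM (vV h2) h1); first by apply: genM => //; apply: genV.
have [s' [e' [hs' ha']]] := aff_iter j ha.
have := kzE (incyl_pre n1 x) ha'; rewrite hk size_cat hs'; nia.
Qed.

(** By compactness: around a point of [F] all group elements are affine on one cylinder, whose depth
    bounds the expansion, and the complement of [F] is open. *)
Let F_kz_bound : exists B : nat, forall x h, F x -> gen S h -> - B%:Z <= kz h x.
Proof.
suff [B hB] : exists B : nat, forall x, incyl [::] x -> forall h, F x -> gen S h -> - B%:Z <= kz h x.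
  by exists B => x h; apply: hB; apply: incyl_nil.
elim/cantor_bar_cover: [::] => [u s [B hB]|u [B hB] [B' hB']|x].
- by exists B => x /incyl_catl; apply: hB.
- exists (maxn B B') => x /incyl_rcons[/hB hx|/hB' hx] h hF hg; have := hx h hF hg; lia.
- have [hF|/existsNP[h /not_implyP[hg /neutral_closed[u hu hn]]]] := pselect (F x); last first.
    by exists u => //; exists 0%N => y /hn hy h' /(_ h hg).
  have [n hn] := F_all_aff hF; exists (pre n x); first exact: incyl_pre.
  exists n => y hy h _ /hn[v [e ha]]; rewrite (kzE hy ha) size_pre; lia.
Qed.

(** The set [F] is invariant, so [F_kz_bound] applies to the inverse of [h] at [h x] and bounds the
    length of the image word. That word and the complementation bit determine [h x]. *)
Lemma finite_orbit x : (forall h, gen S h -> neutral h x) ->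
  exists l : seq stream, forall h, gen S h -> h x \in l.
Proof.
move=> hx; have [n hn] := F_all_aff hx; have [B hB] := F_kz_bound.
have hF h : gen S h -> F (h x).
  move=> hg c hc; have : neutral (vM (vV h) (vM c h)) x.
    by apply: hx; apply: genM; [apply: genV|apply: genM].
  move=> /(neutral_conj h); rewrite (_ : vM h _ = c) //.
  by apply: vaut_eq => y; rewrite !vME !vEV.
exists [seq app v (flip e (fun i => x (n + i)%N)) | v <- words (n + B), e <- [:: true; false]].
move=> h hg; have [v [e ha]] := hn h hg.
have hs : (size v <= n + B)%N.
  have := hB (h x) (vV h) (hF h hg) (genV symS hg); rewrite kzV (kzE (incyl_pre n x) ha) size_pre.
  lia.
apply/allpairsP; exists (v, e); split; rewrite ?mem_words //; first by case: (e).
by rewrite -[in LHS](app_pre n x) ha.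
Qed.

(** Induction on [A]. Let [h0] move [a] out of [B], and let [t b] send [a] to [b] whenever some
    element does. Apply the induction hypothesis to [B] enlarged by the points [t b (vV h0 y)]. If
    the resulting [h] still sends [a] into [B], undo this by the inverse of [t (h a)] and then apply
    [h0]; the enlargement keeps the other points out of [B]. *)
Lemma neumann_separation : (forall x (l : seq stream), exists2 h, gen S h & h x \notin l) ->
  forall A B : seq stream, exists2 h, gen S h & forall x : stream, x \in A -> h x \notin B.
Proof.
move=> hinf; elim=> [|a A IH] B; first by exists v1; [apply: gen_one|].
have [h0 g0 ha0] := hinf a B.
have /choice[t ht] : forall b, exists tb, gen S tb /\
    ((exists2 h, gen S h & h a = b) -> tb a = b).
  move=> b.
  have [[h hg hb]|hn] := pselect (exists2 h, gen S h & h a = b); first by exists h.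
  by exists v1; split => //; apply: gen_one.
have [h hg hh] := IH (B ++ [seq t b (vV h0 y) | b <- B, y <- B]).
have hB x : x \in A -> h x \notin B.
  by move=> /hh; rewrite mem_cat negb_or => /andP[].
case: (boolP (h a \in B)) => haB; last first.
  by exists h => // x; rewrite in_cons => /orP[/eqP -> //|/hB].
have [gt tb] := ht (h a); have {}tb : t (h a) a = h a by apply: tb; exists h.
exists (vM h0 (vM (vV (t (h a))) h)).
  by apply: genM => //; apply: genM => //; apply: genV.
move=> x; rewrite in_cons => /orP[/eqP ->|hx]; rewrite !vME.
  suff -> : vV (t (h a)) (h a) = a by [].
  by apply: (@vfun_inj (t (h a))); rewrite vEV tb.
apply/negP => hin; have := hh x hx; rewrite mem_cat => /norP[_ /negP]; apply.
apply/allpairsP; exists (h a, h0 (vV (t (h a)) (h x))); split => //.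
change (h x = t (h a) (vV h0 (h0 (vV (t (h a)) (h x))))).
by rewrite vVE vEV.
Qed.

End FiniteOrbit.

(** * Ping-pong and the alternative *)

Definition letter (a b : vaut) (l : bool * bool) : vaut :=
  let c := if l.1 then b else a in if l.2 then vV c else c.
Definition word (a b : vaut) (w : seq (bool * bool)) (x : stream) : stream :=
  foldr (fun l y => letter a b l y) x w.

(** A reduced word sends the complement of the set of its inverted last letter into the set of its
    first letter. Of the four letters at least one, [t], is neither of these two, and a point of
    [U t] is moved. *)
Lemma ping_pong (a b : vaut) (U : bool * bool -> stream -> Prop) :
  (forall l x, ~ U (l.1, ~~ l.2) x -> U l (letter a b l x)) ->
  (forall l l' x, U l x -> U l' x -> l = l') ->
  (forall l, exists x, U l x) ->
  forall w, w != [::] -> sorted (fun x y => ~~ ((x.1 == y.1) && (x.2 != y.2))) w ->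
  exists x, word a b w x <> x.
Proof.
move=> hU hdisj hne [//|l w] _ hw.
have key x : ~ U ((last l w).1, ~~ (last l w).2) x -> U l (word a b (l :: w) x).
  elim: w l hw => [|l' w IH] l /=; first by move=> _; apply: hU.
  move=> /andP[hll hw] hx; apply: hU => h; have := hdisj _ _ _ h (IH l' hw hx).
  by move=> e; move: hll; rewrite -e /= eqxx; case: (l.2).
have [t ht1 ht2] : exists2 t, t <> l & t <> ((last l w).1, ~~ (last l w).2).
  case: (l) ((last l w).1, ~~ _) => [[] []] [[] []];
  solve [by exists (true, true)|by exists (true, false)|by exists (false, true)|by exists (false, false)].
have [x hx] := hne t; exists x => e; apply: ht1; apply: (hdisj _ _ x) => //.
by rewrite -e; apply: key => h; apply: ht2; apply: hdisj hx h.
Qed.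

(** By compactness, [neutral_combine] gluing the elements obtained on two halves. *)
Lemma no_neutral (S : vaut -> Prop) : (forall x, exists2 h, gen S h & ~ neutral h x) ->
  exists2 a, gen S a & forall x, ~ neutral a x.
Proof.
move=> hS; suff [a ha h] : exists2 a, gen S a & forall x, incyl [::] x -> ~ neutral a x.
  by exists a => // x; apply: h; apply: incyl_nil.
elim/cantor_bar_cover: [::] => [u s [a ha hu]|u [a ha hu] [b hb hu']|x].
- by exists a => // x /incyl_catl; apply: hu.
- have [n [m h]] := neutral_combine a b.
  exists (vM (vX a n) (vX b m)); first by apply: genM; apply: genX.
  by move=> x /incyl_rcons[/hu hx|/hu' hx] /h [].
- have [h hg /neutral_closed[u hu hn]] := hS x; exists u => //.
  by exists h.
Qed.

Theorem stream_alternative (S : vaut -> Prop) N :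
  (forall s, S s -> unif N s) -> (forall s, S s -> S (vV s)) ->
  (exists a b, [/\ gen S a, gen S b & forall w, w != [::] ->
     sorted (fun x y => ~~ ((x.1 == y.1) && (x.2 != y.2))) w ->
     exists x, word a b w x <> x]) \/
  (exists x (l : seq stream), forall h, gen S h -> h x \in l).
Proof.
move=> hN hV; have [|hfin] := pselect (exists x (l : seq stream), forall h, gen S h -> h x \in l).
  by right.
left.
have hinf x (l : seq stream) : exists2 h, gen S h & h x \notin l.
  apply: contrapT => hn; apply: hfin; exists x, l => h hg; apply/negPn/negP => hx.
  by apply: hn; exists h.
have [x|a ga aT] := @no_neutral S.
  apply: contrapT => hn; apply: hfin; exists x; apply: (finite_orbit hN hV) => h hg.
  by apply: contrapT => hx; apply: hn; exists h.
have [l1 hl1] := rep_finite a; have [l2 hl2] := rep_finite (vV a).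
have [h gh hh] := neumann_separation hV hinf (l1 ++ l2) (l1 ++ l2).
(* A depth at which the cylinders around the repellers and attractors are disjoint and [h] moves
   each of them off all of them. *)
have [||p0 hp0] := @seq_uniform _ [seq (x, y) | x <- l1 ++ l2, y <- l1 ++ l2] (fun n t =>
  (forall z, incyl (pre n t.1) z -> ~~ incyl (pre n t.2) (h z)) /\
  (t.1 <> t.2 -> forall z, incyl (pre n t.1) z -> ~~ incyl (pre n t.2) z)) _ _.
- move=> n m [x y] hnm [/= h1 h2]; split => [z hz|hxy z hz].
    by have := h1 z (incyl_pre_le hnm hz); apply: contra; apply: incyl_pre_le.
  by have := h2 hxy z (incyl_pre_le hnm hz); apply: contra; apply: incyl_pre_le.
- move=> t /allpairsP[[x y] /= [hx hy ->]] /=.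
  have [|n hn] := @stream_neq y (h x); first by move=> e; have := hh x hx; rewrite -e hy.
  have [k hk] := vaut_continuous (incyl_pre n (h x)).
  have [m hm] : exists m, x <> y -> forall z, incyl (pre m x) z -> ~~ incyl (pre m y) z.
    have [->|hxy] := pselect (x = y); first by exists 0%N.
    have [m hm] := stream_neq hxy; exists m => _ z hz; apply: contra hm => hz'.
    exact: incyl_pre_trans hz hz'.
  exists (maxn m (maxn n k)); split => [z hz|hxy z hz].
    apply: contra hn => hz'.
    apply: (@incyl_pre_trans _ _ _ (h z)); first by apply: incyl_pre_le hz'; lia.
    by apply: hk; apply: incyl_pre_le hz; lia.
  have hz' : incyl (pre m x) z by apply: incyl_pre_le hz; lia.
  by apply: contra (hm hxy z hz'); apply: incyl_pre_le; lia.
have {}hp0 x y : x \in l1 ++ l2 -> y \in l1 ++ l2 ->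
  (forall z, incyl (pre p0 x) z -> ~~ incyl (pre p0 y) (h z)) /\
  (x <> y -> forall z, incyl (pre p0 x) z -> ~~ incyl (pre p0 y) z).
  move=> hx hy; apply: (hp0 p0 (x, y) (leqnn _)); apply/allpairsP.
  by exists (x, y).
have [J1 hJ1] := attracted a p0; have [J2 hJ2] := attracted (vV a) p0.
pose J := (J1 + J2)%N.
pose b := vM h (vM (vX a J) (vV h)).
pose V (i : bool) := nearby p0 (if i then rep a else att a).
have Vl i x : V i x -> exists2 y, y \in l1 ++ l2 & incyl (pre p0 y) x.
  by case: i => -[y hy hx]; exists y => //; rewrite mem_cat ?(hl1 _ hy) // (hl2 _ hy) orbT.
have Vd i j x : V i x -> V j x -> i = j.
  have hd z : V true z -> V false z -> False.
    move=> [y hy hz] [y' hy' hz'].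
    have e : y <> y' by move=> e; subst y'; apply: (rep_att hy).
    have [||_ hno] := hp0 y y'; rewrite ?mem_cat ?(hl1 _ hy) ?(hl2 _ hy') ?orbT //.
    by have := hno e _ hz; rewrite hz'.
  by case: i; case: j => // h1 h2; [case: (hd x)|case: (hd x)].
have Vh i j x : V i x -> V j (h x) -> False.
  move=> /Vl[y hy hx] /Vl[y' hy' hx']; have [hno _] := hp0 y y' hy hy'.
  by have := hno _ hx; rewrite hx'.
have Vmap0 x : ~ V true x -> V false (vX a J x).
  by move=> hx; apply: hJ1 => //; rewrite /J; lia.
have Vmap1 x : ~ V false x -> V true (vV (vX a J) x).
  move=> hx; have := hJ2 J x; rewrite -vXV /att vVK; apply => //; first by rewrite /J; lia.
  by rewrite neutralV.
(* A letter pushes points towards the attractors of [a], its inverse towards the repellers; for the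
   conjugate [b] these sets are transported by [h]. *)
pose U l x := V l.2 (if l.1 then vV h x else x).
exists (vX a J), b; split; first exact: genX.
  by apply: genM => //; apply: genM; [apply: genX|apply: genV].
apply: (@ping_pong _ _ U).
- have eb : vV b = vM h (vM (vV (vX a J)) (vV h)) by apply: vaut_eq.
  move=> [[] []] x; rewrite /U /letter /= ?eb ?vME ?vfunK => hx.
  + exact: Vmap1.
  + exact: Vmap0.
  + exact: Vmap1.
  + exact: Vmap0.
- move=> [[] i] [[] j] x; rewrite /U /= => h1 h2; last 2 first.
  + by have := Vh _ _ _ h2; rewrite vEV => /(_ _ h1).
  + by rewrite (Vd _ _ _ h1 h2).
  + by rewrite (Vd _ _ _ h1 h2).
  by case: (Vh i j (vV h x)); rewrite ?vEV.
(* If [V i] were empty, then [V (~~ i)] would be everything, as points outside it are sent into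
   [V i]; but [h] moves [V (~~ i)] off itself. *)
have Vne i : exists x, V i x.
  apply: contrapT => hn; pose x : stream := xpred0.
  have hV' y : V (~~ i) y.
    by case: i hn => hn; apply: contrapT; [move=> /Vmap1 hy|move=> /Vmap0 hy]; apply: hn; eexists; apply: hy.
  exact: (Vh _ _ x (hV' x) (hV' (h x))).
move=> [[] i]; have [x hx] := Vne i; last by exists x.
by exists (h x); rewrite /U /= vfunK.
Qed.

(** * Addresses in the ternary Cantor set *)

Local Open Scope classical_set_scope.
Local Open Scope ring_scope.

Lemma eq0_of_geometric (R : realType) (a C q : R) : 0 <= q < 1 ->
  (forall n, `|a| <= C * q ^+ n) -> a = 0.
Proof.
move=> /andP[q0 q1] h; apply/normr0_eq0/eqP; rewrite eq_le normr_ge0 andbT.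
have hc : (fun n => C * q ^+ n) @ \oo --> (C * 0 : R).
  by apply: cvgMr; apply: cvg_expr; rewrite ger0_norm.
rewrite mulr0 in hc; rewrite -(cvg_lim (@Rhausdorff R) hc).
apply: limr_ge; first by apply/cvg_ex; exists 0.
by apply: nearW => n; apply: h.
Qed.

Definition csum {R : realType} (l : R) (n : nat) (x : stream) : R :=
  \sum_(i < n) (x i)%:R * (1 - l) * l ^+ i.
(* The point of the ternary Cantor set with address [x]. *)
Definition cpt {R : realType} (l : R) (x : stream) : R :=
  sup (range (fun n => csum l n x)).
Definition ones : stream := xpredT.
Definition zeros : stream := xpred0.

Section CantorPoints.
Variables (R : realType) (l : R).
Hypothesis hl : 0 < l < 1 / 2.

Let l0 : 0 < l. Proof. by case/andP: hl. Qed.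
Let l1 : l < 1. Proof. by case/andP: hl => _ h; lra. Qed.
Let l2 : 2 * l < 1. Proof. by case/andP: hl => _ h; lra. Qed.
Let ln0 n : 0 < l ^+ n. Proof. exact: exprn_gt0. Qed.

Lemma csum0 x : csum l 0 x = 0. Proof. by rewrite /csum big_ord0. Qed.
Lemma csumS n x : csum l n.+1 x = (x 0%N)%:R * (1 - l) + l * csum l n (fun i => x i.+1).
Proof.
rewrite /csum big_ord_recl expr0 mulr1 big_distrr /=; congr (_ + _).
by apply: eq_bigr => i _; rewrite exprS; ring.
Qed.

Lemma csum_bound n x : 0 <= csum l n x <= 1 - l ^+ n.
Proof.
elim: n x => [|n IH] x; first by rewrite csum0 expr0; lra.
rewrite csumS exprS; have /andP[h1 h2] := IH (fun i => x i.+1).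
have h3 : l * csum l n (fun i => x i.+1) <= l * (1 - l ^+ n) by rewrite ler_pM2l.
have h4 : 0 <= l * csum l n (fun i => x i.+1) by rewrite mulr_ge0 // ltW.
by case: (x 0%N) => /=; move: l1; lra.
Qed.

Lemma csum_diff n m x : (n <= m)%N -> csum l n x <= csum l m x <= csum l n x + l ^+ n.
Proof.
elim: n m x => [|n IH] m x; first by rewrite csum0 expr0 => _; have := csum_bound m x; have := ln0 m; lra.
case: m => // m hm; rewrite !csumS exprS; have /andP[h1 h2] := IH m (fun i => x i.+1) hm.
have := ler_pM2l l0 (csum l n (fun i => x i.+1)) (csum l m (fun i => x i.+1)).
have := ler_pM2l l0 (csum l m (fun i => x i.+1)) (csum l n (fun i => x i.+1) + l ^+ n).
rewrite h1 h2 mulrDr => h3 h4; lra.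
Qed.

Lemma cpt_csum n x : csum l n x <= cpt l x <= csum l n x + l ^+ n.
Proof.
have hb m : csum l m x <= csum l n x + l ^+ n.
  case: (leqP n m) => [/(csum_diff x)/andP[] //|/ltnW/(csum_diff x)/andP[h _]].
  by have := ln0 n; lra.
apply/andP; split.
  by apply: ub_le_sup; [exists (csum l n x + l ^+ n) => _ [m _ <-]|exists n].
by apply: ge_sup; [exists (csum l n x); exists n|move=> _ [m _ <-]].
Qed.

Lemma cpt_cons x : cpt l x = (x 0%N)%:R * (1 - l) + l * cpt l (fun i => x i.+1).
Proof.
apply/eqP; rewrite -subr_eq0; apply/eqP.
apply: (@eq0_of_geometric _ _ 1 l) => [|n]; first by rewrite ltW.
have /andP[h1 h2] := cpt_csum n.+1 x; have /andP[h3 h4] := cpt_csum n (fun i => x i.+1).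
rewrite csumS exprS in h1 h2; set s := csum _ _ _ in h1 h2 h3 h4.
have h5 : l * s <= l * cpt l (fun i => x i.+1) by rewrite ler_pM2l.
have h6 : l * cpt l (fun i => x i.+1) <= l * (s + l ^+ n) by rewrite ler_pM2l.
have h7 : l * l ^+ n <= l ^+ n by rewrite ler_piMl ?ltW.
rewrite mulrDr in h6; rewrite ler_norml; apply/andP; split; lra.
Qed.

Lemma cpt_bound x : 0 <= cpt l x <= 1.
Proof. by have := cpt_csum 0 x; rewrite csum0 expr0; lra. Qed.

(* Left endpoint of the interval with address [u]. *)
Fixpoint clo (u : seq bool) : R :=
  if u is b :: u' then b%:R * (1 - l) + l * clo u' else 0.

Lemma cpt_app u w : cpt l (app u w) = clo u + l ^+ size u * cpt l w.
Proof.
elim: u => [|b u IH] /=; first by rewrite app_nil expr0; lra.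
rewrite cpt_cons (_ : (fun i => _) = app u w); last first.
  by apply/funext => i; rewrite /app /= subSS.
by rewrite IH /app /= exprS; ring.
Qed.

Lemma cpt_zeros : cpt l zeros = 0.
Proof.
have := cpt_cons zeros; rewrite (_ : (fun i => _) = zeros) // /zeros /= => h.
have : (1 - l) * cpt l (xpred0 : stream) = 0 by lra.
by move/eqP; rewrite mulf_eq0 => /orP[/eqP|/eqP //]; move: l1; lra.
Qed.

Lemma cpt_flip w : cpt l (flip true w) = 1 - cpt l w.
Proof.
apply/eqP; rewrite -subr_eq0; apply/eqP.
apply: (@eq0_of_geometric _ _ 1 l) => [|n]; first by rewrite ltW.
elim: n w => [|n IH] w.
  by have := cpt_bound w; have := cpt_bound (flip true w); rewrite expr0 ler_norml; lra.
rewrite !(cpt_cons w) (cpt_cons (flip true w)).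
have := IH (fun i => w i.+1); rewrite /flip; set a := cpt _ _; set b := cpt _ _ => h.
rewrite (_ : _ - _ = l * (a - (1 - b))); last by case: (w 0%N) => /=; ring.
by rewrite normrM gtr0_norm // exprS mulrCA ler_pM2l.
Qed.

Lemma cpt_ones : cpt l ones = 1.
Proof. by rewrite (_ : ones = flip true zeros) // cpt_flip cpt_zeros subr0. Qed.

Lemma cpt_gap u x y : incyl (rcons u false) x -> incyl (rcons u true) y ->
  l ^+ size u * (1 - 2 * l) <= cpt l y - cpt l x.
Proof.
move=> /incylP[w ->] /incylP[z ->]; rewrite -!cats1 !app_cat !cpt_app /= !expr1.
have /andP[a1 a2] := cpt_bound w; have /andP[b1 b2] := cpt_bound z.
have -> : clo u + l ^+ size u * (1%:R * (1 - l) + l * 0 + l * cpt l z) -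
  (clo u + l ^+ size u * (0%:R * (1 - l) + l * 0 + l * cpt l w)) =
  l ^+ size u * (1 - l + l * cpt l z - l * cpt l w) by ring.
rewrite ler_pM2l //.
have : 0 <= l * cpt l z by rewrite mulr_ge0 // ltW.
have : l * cpt l w <= l * 1 by rewrite ler_pM2l.
lra.
Qed.

Lemma cpt_diam u x y : incyl u x -> incyl u y -> `|cpt l x - cpt l y| <= l ^+ size u.
Proof.
move=> /incylP[w ->] /incylP[z ->]; rewrite !cpt_app.
rewrite (_ : _ - _ = l ^+ size u * (cpt l w - cpt l z)); last by ring.
rewrite normrM gtr0_norm // ler_piMr ?(ltW (ln0 _)) //.
by have := cpt_bound w; have := cpt_bound z; rewrite ler_norml; lra.
Qed.

Lemma gap_pos n : 0 < l ^+ n * (1 - 2 * l).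
Proof. by rewrite mulr_gt0 // subr_gt0. Qed.

Lemma cpt_split x y : cpt l x < cpt l y -> exists2 u, incyl (rcons u false) x & incyl (rcons u true) y.
Proof.
move=> h; have [|u [[] [hx hy]]] := @stream_split x y; first by move=> e; move: h; rewrite e ltxx.
  by have := cpt_gap hy hx; have := gap_pos (size u); lra.
by exists u.
Qed.

Lemma cpt_inj : injective (cpt l).
Proof.
move=> x y h; apply: contrapT => /stream_split[u [[] [hx hy]]].
  by have := cpt_gap hy hx; have := gap_pos (size u); lra.
by have := cpt_gap hx hy; have := gap_pos (size u); lra.
Qed.

Lemma incyl_rcons_lt u v b x : incyl u x -> incyl (rcons v b) x -> (size v < size u)%N ->
  exists s, u = rcons v b ++ s.
Proof. by move=> hu hv h; apply: incyl_cat hv hu _; rewrite size_rcons. Qed.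

(** Addresses that differ before rank [n] are separated by a gap longer than this bound. *)
Lemma cpt_close n x y : `|cpt l x - cpt l y| < l ^+ n * (1 - 2 * l) -> incyl (pre n x) y.
Proof.
move=> h; have [->|/stream_split[u [b [hx hy]]]] := pselect (x = y); first exact: incyl_pre.
have hg : l ^+ size u * (1 - 2 * l) <= `|cpt l x - cpt l y|.
  case: b hx hy => hx hy.
    by rewrite (le_trans (cpt_gap hy hx)) // ler_norm.
  by rewrite distrC (le_trans (cpt_gap hx hy)) // ler_norm.
have : l ^+ size u * (1 - 2 * l) < l ^+ n * (1 - 2 * l) by lra.
rewrite ltr_pM2r ?subr_gt0 // => hlt.
have hn : (n <= size u)%N.
  rewrite leqNgt; apply/negP => hlt'.
  have : l ^+ n <= l ^+ size u by apply: ler_wiXn2l; [exact: ltW|exact: ltW|exact: ltnW].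
  lra.
have [s hs] : exists s, u = pre n x ++ s.
  apply: (@incyl_cat _ _ x); rewrite ?incyl_pre ?size_pre //.
  by apply: (@incyl_catl u [:: b]); rewrite cats1.
by apply: (@incyl_catl _ (s ++ [:: ~~ b])); rewrite catA -hs cats1.
Qed.

(** The order of the points is the lexicographic order of the addresses: leaving [u] to the right of
    [x] means crossing a gap that has [y] on its left. *)
Lemma cpt_convex u x y z : incyl u x -> incyl u y ->
  cpt l x <= cpt l z -> cpt l z <= cpt l y -> incyl u z.
Proof.
move=> hx hy; rewrite le_eqVlt => /orP[/eqP/cpt_inj <- //|/cpt_split[v hxv hzv]] hzy.
case: (leqP (size u) (size v)) => hs.
  have hxv' : incyl v x by apply: (@incyl_catl _ [:: false]); rewrite cats1.
  have [s es] := incyl_cat hx hxv' hs.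
  by apply: (@incyl_catl _ (s ++ [:: true])); rewrite catA -es cats1.
have [s es] := incyl_rcons_lt hx hxv hs.
have hyv : incyl (rcons v false) y by apply: (@incyl_catl _ s); rewrite -es.
by have := cpt_gap hyv hzv; have := gap_pos (size v); lra.
Qed.

(* Endpoints of the gap removed from the interval with address [u]. *)
Definition gapL (u : seq bool) : stream := app (rcons u false) ones.
Definition gapR (u : seq bool) : stream := app (rcons u true) zeros.

Lemma cpt_gapL u : cpt l (gapL u) = clo u + l ^+ size u * l.
Proof. by rewrite /gapL -cats1 app_cat !cpt_app /= cpt_ones expr1; ring. Qed.
Lemma cpt_gapR u : cpt l (gapR u) = clo u + l ^+ size u * (1 - l).
Proof. by rewrite /gapR -cats1 app_cat !cpt_app /= cpt_zeros expr1; ring. Qed.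

Lemma cpt_gapLR u : cpt l (gapR u) - cpt l (gapL u) = l ^+ size u * (1 - 2 * l).
Proof. by rewrite cpt_gapL cpt_gapR; ring. Qed.

Lemma gapL_max u x : incyl (rcons u false) x -> cpt l x <= cpt l (gapL u).
Proof.
move=> /incylP[w ->]; rewrite /gapL !cpt_app lerD2l ler_pM2l // cpt_ones.
by have /andP[] := cpt_bound w.
Qed.
Lemma gapR_min u x : incyl (rcons u true) x -> cpt l (gapR u) <= cpt l x.
Proof.
move=> /incylP[w ->]; rewrite /gapR !cpt_app lerD2l ler_pM2l // cpt_zeros.
by have /andP[] := cpt_bound w.
Qed.

Lemma gap_empty u z : ~ (cpt l (gapL u) < cpt l z < cpt l (gapR u)).
Proof.
move=> /andP[h1 h2]; have hz : incyl u z.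
  apply: (@cpt_convex _ (gapL u) (gapR u)); rewrite ?ltW //.
    by apply: (@incyl_catl _ [:: false]); rewrite cats1 incyl_app.
  by apply: (@incyl_catl _ [:: true]); rewrite cats1 incyl_app.
have [hb|hb] := incyl_rcons hz; last by have := gapR_min hb; lra.
by have := gapL_max hb; lra.
Qed.

Lemma adjacent_gap x y : cpt l x < cpt l y -> (forall z, ~ (cpt l x < cpt l z < cpt l y)) ->
  exists v, x = gapL v /\ y = gapR v.
Proof.
move=> hxy hz; have [v hx hy] := cpt_split hxy; exists v.
have h1 := gapL_max hx; have h2 := gapR_min hy; have h3 := cpt_gapLR v; have h4 := gap_pos (size v).
split; apply: cpt_inj; apply/eqP; rewrite eq_le; apply/andP; split => //.
  by rewrite leNgt; apply/negP => h; apply: (hz (gapL v)); rewrite h; lra.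
by rewrite leNgt; apply/negP => h; apply: (hz (gapR v)); rewrite h; lra.
Qed.

End CantorPoints.

(** * Rigidity of differentiable maps of the Cantor set *)

(* Strict differentiability along the Cantor set. *)
Definition strict_at {R : realType} (l : R) (phi : stream -> stream) (x : stream) (d : R) :=
  forall eps, 0 < eps -> exists n, forall y z, incyl (pre n x) y -> incyl (pre n x) z ->
    `|cpt l (phi y) - cpt l (phi z) - d * (cpt l y - cpt l z)| <= eps * `|cpt l y - cpt l z|.

Section Rigidity.
Variables (R : realType) (l : R).
Hypothesis hl : 0 < l < 1 / 2.

Let l0 : 0 < l. Proof. by case/andP: hl. Qed.
Let l1 : l < 1. Proof. by case/andP: hl => _ h; lra. Qed.
Let l2 : 2 * l < 1. Proof. by case/andP: hl => _ h; lra. Qed.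
Let ln0 n : 0 < l ^+ n. Proof. exact: exprn_gt0. Qed.
Let lnle n m : (n <= m)%N -> l ^+ m <= l ^+ n.
Proof. by move=> h; apply: ler_wiXn2l; [exact: ltW|exact: ltW|]. Qed.

Lemma exists_small_power a : 0 < a -> exists n, forall m, (n <= m)%N -> l ^+ m < a.
Proof.
move=> a0; have [n hn] : exists n, l ^+ n < a.
  apply: contrapT => hn; suff : a = 0 by move: a0; lra.
  apply: (@eq0_of_geometric _ _ 1 l) => [|n]; first by rewrite ltW.
  by rewrite gtr0_norm // mul1r leNgt; apply/negP => h; apply: hn; exists n.
by exists n => m /lnle h; lra.
Qed.

Lemma strict_cont phi x d n : strict_at l phi x d ->
  exists m, forall y, incyl (pre m x) y -> incyl (pre n (phi x)) (phi y).
Proof.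
move=> h; have [n0 hn0] := h 1 ltr01.
have hd : 0 < `|d| + 1 by have := normr_ge0 d; lra.
have [m hm] := @exists_small_power (l ^+ n * (1 - 2 * l) / (`|d| + 1)) (divr_gt0 (gap_pos hl n) hd).
exists (n0 + m)%N => y hy; apply: (cpt_close hl).
have := hn0 x y (incyl_pre _ _) (incyl_pre_le (leq_addr _ _) hy).
have := hm _ (leq_addl n0 m); rewrite ltr_pdivlMr //.
have := cpt_diam hl (incyl_pre (n0 + m) x) hy; rewrite size_pre.
set D := cpt l x - cpt l y; set E := cpt l _ - _; move=> h1 h2 h3.
have h4 : `|E| <= `|E - d * D| + `|d| * `|D| by rewrite -normrM -{1}(subrK (d * D) E) ler_normD.
have : (`|d| + 1) * `|D| <= (`|d| + 1) * l ^+ (n0 + m) by rewrite ler_pM2l.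
lra.
Qed.

Lemma pair_in_pre n x : exists y z, [/\ incyl (pre n x) y, incyl (pre n x) z & cpt l y <> cpt l z].
Proof.
exists (app (pre n x) ones), (app (pre n x) zeros); split; rewrite ?incyl_app //.
by move=> /(cpt_inj hl)/app_inj/(congr1 (fun f => f 0%N)).
Qed.

Lemma strict_neq0 phi psi x d d' : cancel phi psi ->
  strict_at l phi x d -> strict_at l psi (phi x) d' -> d <> 0.
Proof.
move=> hK h h' e; subst d.
have hd : 0 < `|d'| + 1 by have := normr_ge0 d'; lra.
(* Chosen so that composing with the estimate for [psi] yields [|D| <= |D| / 2] for a nonzero
   [D]. *)
have [|n hn] := h (1 / (2 * (`|d'| + 1))); first by rewrite divr_gt0 // mulr_gt0.
have [m hm] := h' 1 ltr01.
have [k hk] := strict_cont m h.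
have [y [z [hy hz hyz]]] := pair_in_pre (n + k) x.
have h1 := hn y z (incyl_pre_le (leq_addr _ _) hy) (incyl_pre_le (leq_addr _ _) hz).
have h2 := hm _ _ (hk _ (incyl_pre_le (leq_addl _ _) hy)) (hk _ (incyl_pre_le (leq_addl _ _) hz)).
rewrite !hK in h2; move: h1 h2.
have : cpt l y - cpt l z != 0 by rewrite subr_eq0; apply/eqP.
set D := cpt l y - _; set E := cpt l _ - _; rewrite -normr_gt0 mul0r subr0 => D0 h1 h2.
have h3 : `|D| <= `|D - d' * E| + `|d'| * `|E| by rewrite -normrM -{1}(subrK (d' * E) D) ler_normD.
have h4 : (2 * (`|d'| + 1)) * `|E| <= `|D|.
  have : (2 * (`|d'| + 1)) * `|E| <= (2 * (`|d'| + 1)) * (1 / (2 * (`|d'| + 1)) * `|D|).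
    by rewrite ler_pM2l // mulr_gt0.
  by rewrite mulrA div1r mulfV ?mul1r // gt_eqF // mulr_gt0.
lra.
Qed.

(** Since [2 * l < 1], distinct powers of [l] cannot both lie between [c] and [c * 2]. *)
Lemma l_pow_cmp a b c : 0 < c -> l ^+ a <= c * 2 -> c <= l ^+ b -> (b <= a)%N.
Proof.
move=> c0 h1 h2; rewrite leqNgt; apply/negP => hlt.
have h3 : l ^+ b <= l ^+ a.+1 by apply: lnle.
rewrite exprS in h3; have h4 : l * l ^+ a <= l * (c * 2) by rewrite ler_pM2l.
have : c * (2 * l) < c * 1 by rewrite ltr_pM2l.
lra.
Qed.

(* Gaps go to gaps, and near [x] the ratio of their lengths is a
   power of [l] that varies by a factor at most 2 < 1 / l, hence is constant;
   so [phi] is affine up to an error [E] that is additive over the two halves of a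
   cylinder; halving [i] times gives [E = O((2 * l) ^ i)], that is [E = 0]. *)
Lemma rigid_pos phi psi x d d' : cancel phi psi -> cancel psi phi -> 0 < d ->
  strict_at l phi x d -> strict_at l psi (phi x) d' ->
  exists u, incyl u x /\ exists v, aff phi u v false.
Proof.
move=> hK hK' d0 h h'.
(* With [d / 3] the slopes lie between [2 / 3 * d] and [4 / 3 * d], the factor 2 required by
   [l_pow_cmp]. *)
have [|n1 hn1] := h (d / 3); first by lra.
have [n2 hn2] := strict_cont n1 h'; rewrite hK in hn2.
have [n3 hn3] := strict_cont n2 h.
pose n := (n1 + n3)%N; pose u := pre n x.
have phi_le y z : incyl (pre n1 x) y -> incyl (pre n1 x) z -> cpt l y <= cpt l z ->
   2 / 3 * d * (cpt l z - cpt l y) <= cpt l (phi z) - cpt l (phi y) <= 4 / 3 * d * (cpt l z - cpt l y).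
  move=> hy hz hyz; have := hn1 _ _ hz hy; rewrite (ger0_norm (_ : 0 <= cpt l z - cpt l y)) ?subr_ge0 //.
  by rewrite ler_norml => /andP[]; lra.
have phi_lt y z : incyl (pre n1 x) y -> incyl (pre n1 x) z -> cpt l y < cpt l z -> cpt l (phi y) < cpt l (phi z).
  move=> hy hz hyz; have /andP[h1 _] := phi_le _ _ hy hz (ltW hyz).
  have : 0 < 2 / 3 * d * (cpt l z - cpt l y) by rewrite mulr_gt0 ?subr_gt0 // mulr_gt0 //; lra.
  lra.
have in1 s y : incyl (u ++ s) y -> incyl (pre n1 x) y.
  by move=> /incyl_catl; apply: incyl_pre_le; rewrite leq_addr.
have in3 s y : incyl (u ++ s) y -> incyl (pre n2 (phi x)) (phi y).
  by move=> /incyl_catl hy; apply: hn3; apply: incyl_pre_le hy; rewrite leq_addl.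
have gL s : incyl s (gapL s) by apply: (@incyl_catl _ [:: false]); rewrite cats1 incyl_app.
have gR s : incyl s (gapR s) by apply: (@incyl_catl _ [:: true]); rewrite cats1 incyl_app.
have g_lt s : cpt l (gapL s) < cpt l (gapR s).
  by have := cpt_gapLR hl s; have := gap_pos hl (size s); lra.
(* A Cantor point strictly between the two images would, by continuity of [psi] and monotonicity of
   [phi], come from a Cantor point inside the gap. *)
have gaps s : exists v, phi (gapL (u ++ s)) = gapL v /\ phi (gapR (u ++ s)) = gapR v.
  have hL := gL (u ++ s); have hR := gR (u ++ s).
  apply: (adjacent_gap hl); first by apply: phi_lt (g_lt _); [apply: in1 hL|apply: in1 hR].
  move=> z /andP[z1 z2].
  have hz : incyl (pre n2 (phi x)) z.
    apply: (cpt_convex hl) (ltW z1) (ltW z2); [exact: in3 hL|exact: in3 hR].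
  have hpz := hn2 _ hz.
  apply: (gap_empty hl (u := u ++ s) (z := psi z)); apply/andP; split.
    rewrite ltNge; apply/negP; rewrite le_eqVlt => /orP[/eqP/(cpt_inj hl) e|hlt].
      by move: z1; rewrite -e hK' ltxx.
    by have := phi_lt _ _ hpz (in1 _ _ hL) hlt; rewrite hK'; lra.
  rewrite ltNge; apply/negP; rewrite le_eqVlt => /orP[/eqP/(cpt_inj hl) e|hlt].
    by move: z2; rewrite e hK' ltxx.
  by have := phi_lt _ _ (in1 _ _ hR) hpz hlt; rewrite hK'; lra.
have /choice[v hv] := gaps.
have hvl s : 2 / 3 * d * l ^+ size (u ++ s) <= l ^+ size (v s) <= 4 / 3 * d * l ^+ size (u ++ s).
  have := phi_le _ _ (in1 _ _ (gL (u ++ s))) (in1 _ _ (gR (u ++ s))) (ltW (g_lt _)).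
  have [-> ->] := hv s; rewrite !(cpt_gapLR hl) !mulrA.
  by rewrite !ler_pM2r // subr_gt0.
have hsz s : size (v s) = (size (v [::]) + size s)%N.
  have := hvl s; have := hvl [::]; rewrite cats0 size_cat exprD.
  set a := l ^+ size u; set b := l ^+ size s; move=> /andP[h1 h2] /andP[h3 h4].
  have a0 : 0 < a by apply: ln0.
  have b0 : 0 < b by apply: ln0.
  have p0 : 0 < 2 / 3 * d * (a * b) by rewrite !mulr_gt0 //; lra.
  have h5 : l ^+ (size (v [::]) + size s) <= 4 / 3 * d * (a * b) by rewrite exprD mulrA ler_pM2r.
  have h6 : 2 / 3 * d * (a * b) <= l ^+ (size (v [::]) + size s) by rewrite exprD mulrA ler_pM2r.
  by apply/eqP; rewrite eqn_leq; apply/andP; split; apply: (l_pow_cmp p0) => //; lra.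
pose D := l ^+ size (v [::]) / l ^+ size u.
have hgap s : cpt l (phi (gapR (u ++ s))) - cpt l (phi (gapL (u ++ s))) =
    D * (cpt l (gapR (u ++ s)) - cpt l (gapL (u ++ s))).
  have [-> ->] := hv s; rewrite !(cpt_gapLR hl) hsz size_cat /D !exprD.
  by field; rewrite gt_eqF.
pose E y z := cpt l (phi y) - cpt l (phi z) - D * (cpt l y - cpt l z).
have D0 : 0 < D by rewrite divr_gt0.
pose C := 4 / 3 * d + D.
have C0 : 0 < C by rewrite /C; lra.
have hE0 s y z : incyl (u ++ s) y -> incyl (u ++ s) z -> `|E y z| <= C * l ^+ size (u ++ s).
  wlog hyz : y z / cpt l y <= cpt l z.
    move=> H hy hz; case: (leP (cpt l y) (cpt l z)) => hyz; first exact: H.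
    rewrite (_ : E y z = - E z y) ?normrN; first by apply: H => //; apply: ltW.
    by rewrite /E; ring.
  move=> hy hz; have /andP[h1 h2] := phi_le _ _ (in1 _ _ hy) (in1 _ _ hz) hyz.
  have := cpt_diam hl hy hz; rewrite distrC ger0_norm ?subr_ge0 //.
  set t := l ^+ _; set w := cpt l z - cpt l y in h1 h2 *; move=> h3.
  have hE : E y z = D * w - (cpt l (phi z) - cpt l (phi y)) by rewrite /E /w; ring.
  have w0 : 0 <= w by rewrite subr_ge0.
  have h4 : C * w <= C * t by rewrite ler_pM2l.
  have h5 : 0 <= 2 / 3 * d * w by rewrite mulr_ge0 //; lra.
  have h6 : 0 <= D * w by rewrite mulr_ge0 // ltW.
  rewrite hE ler_norml; apply/andP; split; move: h4; rewrite /C; lra.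
have hEi i s y z : incyl (u ++ s) y -> incyl (u ++ s) z -> `|E y z| <= C * l ^+ size (u ++ s) * (2 * l) ^+ i.
  elim: i s y z => [|i IH] s y z hy hz; first by rewrite expr0 mulr1; apply: hE0.
  have IH1 b y' z' : incyl (rcons (u ++ s) b) y' -> incyl (rcons (u ++ s) b) z' ->
      `|E y' z'| <= C * l ^+ size (u ++ s) * (2 * l) ^+ i * l.
    rewrite rcons_cat => hy' hz'; apply: le_trans (IH _ _ _ hy' hz') _.
    rewrite le_eqVlt; apply/orP; left; apply/eqP.
    by rewrite -rcons_cat size_rcons exprS; ring.
  rewrite exprS (_ : C * _ * _ = C * l ^+ size (u ++ s) * (2 * l) ^+ i * l * 2); last by ring.
  set K := C * _ * _ * _ in IH1 *.
  have K0 : 0 <= K by rewrite /K !mulr_ge0 // ?exprn_ge0 // ?mulr_ge0 // ltW.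
  (* By [hgap] the error vanishes between the two ends of the gap, so it splits into one error on
     each side. *)
  have cross y' z' : incyl (rcons (u ++ s) false) y' -> incyl (rcons (u ++ s) true) z' -> `|E y' z'| <= K * 2.
    move=> hy' hz'.
    have e : E y' z' = E y' (gapL (u ++ s)) + E (gapR (u ++ s)) z'.
      by have := hgap s; rewrite /E; lra.
    rewrite e; apply: le_trans (ler_normD _ _) _.
    have := IH1 _ _ _ hy' (incyl_app _ _ : incyl (rcons (u ++ s) false) (gapL (u ++ s))).
    have := IH1 _ _ _ (incyl_app _ _ : incyl (rcons (u ++ s) true) (gapR (u ++ s))) hz'.
    lra.
  have [hy0|hy1] := incyl_rcons hy; have [hz0|hz1] := incyl_rcons hz.
  - by have := IH1 _ _ _ hy0 hz0; lra.
  - exact: cross.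
  - rewrite (_ : E y z = - E z y) ?normrN; first exact: cross.
    by rewrite /E; ring.
  - by have := IH1 _ _ _ hy1 hz1; lra.
have hE y z : incyl u y -> incyl u z -> E y z = 0.
  rewrite -[u]cats0 => hy hz.
  apply: (@eq0_of_geometric _ _ (C * l ^+ size (u ++ [::])) (2 * l)); first by move: l0 l2; lra.
  by move=> i; apply: hEi.
exists u; split; first exact: incyl_pre.
exists (v [::]) => w; rewrite flip0; apply: (cpt_inj hl).
have [e1 _] := hv [::]; rewrite cats0 in e1.
have := hE (app u w) (gapL u) (incyl_app _ _) (gL _).
rewrite /E e1 !(cpt_gapL hl) !(cpt_app hl) => h1.
apply/eqP; rewrite -subr_eq0; apply/eqP; rewrite -[RHS]h1 /D.
by field; rewrite gt_eqF.
Qed.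

Lemma strict_flip_l phi x d : strict_at l phi x d -> strict_at l (flip true \o phi) x (- d).
Proof.
move=> h eps e0; have [n hn] := h _ e0; exists n => y z hy hz /=.
rewrite !(cpt_flip hl) (_ : _ - _ - _ = - (cpt l (phi y) - cpt l (phi z) - d * (cpt l y - cpt l z))).
  by rewrite normrN; apply: hn.
ring.
Qed.

Lemma pre_flip n e x : pre n (flip e x) = lflip e (pre n x).
Proof. by rewrite /pre /mkseq /lflip -map_comp. Qed.

Lemma incyl_flip n e x y : incyl (pre n x) y -> incyl (pre n (flip e x)) (flip e y).
Proof. by rewrite /incyl !size_pre !pre_flip => /eqP ->. Qed.

Lemma strict_flip_r psi x d : strict_at l psi (flip true x) d ->
  strict_at l (psi \o flip true) x (- d).
Proof.
move=> h eps e0; have [n hn] := h _ e0; exists n => y z /(incyl_flip true) hy /(incyl_flip true) hz /=.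
have := hn _ _ hy hz; rewrite !(cpt_flip hl).
rewrite (_ : 1 - cpt l y - (1 - cpt l z) = - (cpt l y - cpt l z)); last by ring.
by rewrite normrN mulrN mulNr.
Qed.

(** Complementing all digits reverses the Cantor set and changes the sign of the derivative, which
    reduces the case [d < 0] to [rigid_pos]. *)
Lemma rigid phi psi x d d' : cancel phi psi -> cancel psi phi ->
  strict_at l phi x d -> strict_at l psi (phi x) d' ->
  exists u, incyl u x /\ exists v e, aff phi u v e.
Proof.
move=> hK hK' h h'; case: (ltgtP d 0) => [d0|d0|e]; last by case: (strict_neq0 hK h h').
- have h1 : strict_at l (psi \o flip true) ((flip true \o phi) x) (- d').
    by apply: strict_flip_r; rewrite /= flipK.
  have [|||u [hu [v hv]]] := rigid_pos _ _ _ (strict_flip_l h) h1.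
  + by move=> y /=; rewrite flipK hK.
  + by move=> y /=; rewrite hK' flipK.
  + lra.
  exists u; split => //; exists (lflip true v), true => w.
  by rewrite -[LHS](flipK true) -[flip true (phi _)]/((flip true \o phi) _) hv flip_app flip0.
- by have [u [hu [v hv]]] := rigid_pos hK hK' d0 h h'; exists u; split => //; exists v, false.
Qed.

End Rigidity.

(** * The ternary Cantor set as the set of points with an address *)

Section TernaryCantor.
Variables (R : realType) (l : R).
Hypothesis hl : 0 < l < 1 / 2.

Let l0 : 0 < l. Proof. by case/andP: hl. Qed.
Let ln0 n : 0 < l ^+ n. Proof. exact: exprn_gt0. Qed.

Lemma clo_rcons u b : clo l (rcons u b) = clo l u + l ^+ size u * (b%:R * (1 - l)).
Proof. by elim: u => [|b' u IH] /=; rewrite ?expr0 ?IH ?exprS; ring. Qed.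

Lemma cantor_intervalsP n (J : R * R) : J \in cantor_intervals l n <->
  exists2 u, size u = n & J = (clo l u, clo l u + l ^+ n).
Proof.
elim: n J => [|n IH] J.
  rewrite /= inE expr0; split=> [/eqP ->|[u /size0nil -> ->]]; last by rewrite /= add0r.
  by exists [::]; rewrite //= add0r.
have ch u : size u = n ->
    [:: (clo l u, clo l u + l * (clo l u + l ^+ n - clo l u));
        (clo l u + l ^+ n - l * (clo l u + l ^+ n - clo l u), clo l u + l ^+ n)] =
    [seq (clo l (rcons u b), clo l (rcons u b) + l ^+ n.+1) | b <- [:: false; true]].
  move=> hu; have e0 : clo l (rcons u false) = clo l u by rewrite clo_rcons mul0r mulr0 addr0.
  have e1 : clo l (rcons u true) = clo l u + l ^+ n * (1 - l) by rewrite clo_rcons mul1r hu.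
  rewrite /= e0 e1 exprS; congr [:: (_, _); (_, _)]; ring.
split=> [/flatten_mapP[J' /IH[u hu ->]]|[u]].
  rewrite ch // => /mapP[b _ ->]; exists (rcons u b) => //.
  by rewrite size_rcons hu.
case/lastP: u => // u b; rewrite size_rcons => -[hu] ->.
apply/flatten_mapP; exists (clo l u, clo l u + l ^+ n); first by apply/IH; exists u.
by rewrite ch //; apply/mapP; exists b => //; case: b.
Qed.

(** By compactness a point outside the range stays at positive distance from it. A point [t] of the
    Cantor set lies within [l ^+ n] of the left endpoint of an interval of level [n], and that
    endpoint has an address. *)
Lemma ternary_cantorE : ternary_cantor l = range (cpt l).
Proof.
apply/seteqP; split=> [t ht|_ [x _ <-] n _]; last first.
  exists (clo l (pre n x), clo l (pre n x) + l ^+ n).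
    by apply/cantor_intervalsP; exists (pre n x); rewrite ?size_pre.
  have e : cpt l x = clo l (pre n x) + l ^+ n * cpt l (fun i => x (n + i)%N).
    by rewrite -{1}(app_pre n x) cpt_app // size_pre.
  rewrite /= in_itv /= e.
  by have /andP[h1 h2] := cpt_bound hl (fun i => x (n + i)%N); rewrite lerDl lerD2l mulr_ge0 ?ler_piMr // ltW.
apply: contrapT => hn.
suff [eta eta0 h] : exists2 eta, 0 < eta & forall x, incyl [::] x -> eta <= `|cpt l x - t|.
  have [n hn'] := exists_small_power hl eta0; have := hn' n (leqnn n).
  have [J /cantor_intervalsP[u hu ->]] := ht n I; rewrite /= in_itv /= => /andP[h1 h2].
  have := h (app u zeros) (incyl_nil _); rewrite cpt_app // cpt_zeros // mulr0 addr0.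
  have : `|clo l u - t| <= l ^+ n by rewrite distrC ger0_norm; lra.
  lra.
elim/cantor_bar_cover: [::] => [u s [e e0 he]|u [e e0 he] [e' e0' he']|x].
- by exists e => // x /incyl_catl; apply: he.
- exists (Num.min e e'); first by rewrite lt_min e0.
  by move=> x /incyl_rcons[/he h|/he' h]; rewrite ge_min h ?orbT.
have d0 : 0 < `|cpt l x - t| / 2.
  rewrite divr_gt0 // normr_gt0 subr_eq0; apply/eqP => e; apply: hn; by exists x.
have [n hn'] := exists_small_power hl d0.
exists (pre n x); first exact: incyl_pre.
exists (`|cpt l x - t| / 2) => // y hy.
have := hn' n (leqnn n); have := cpt_diam hl (incyl_pre n x) hy; rewrite size_pre.
have := ler_distD (cpt l y) (cpt l x) t; lra.
Qed.

Lemma ternary_cantor01 x : cpt l x \in `[0, 1].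
Proof. by rewrite in_itv /=; apply: cpt_bound. Qed.

End TernaryCantor.

(** * Diffeomorphisms along an embedded segment *)

Section C1.
Variable R : realType.

(** By the mean value theorem the difference quotient is a derivative at a point close to [t0]. *)
Lemma C1_strict (h : R -> R) (t0 : R) :
  (\forall t \near t0, derivable h t 1) -> {for t0, continuous ('D_1 h)} ->
  forall eps, 0 < eps -> exists2 del, 0 < del & forall s t,
    `|s - t0| < del -> `|t - t0| < del ->
    `|h s - h t - 'D_1 h t0 * (s - t)| <= eps * `|s - t|.
Proof.
move=> hder hcont eps eps0.
have hc : \forall t \near t0, `|'D_1 h t - 'D_1 h t0| < eps.
  by move/cvgrPdist_lt : hcont => /(_ _ eps0); apply: filterS => t; rewrite distrC.
have : nbhs t0 [set t | derivable h t 1 /\ `|'D_1 h t - 'D_1 h t0| < eps].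
  exact: filterI hder hc.
move=> /nbhs_ballP[del /= del0 hdel].
exists del => // s t hs ht.
have hb u : `|u - t0| < del -> derivable h u 1 /\ `|'D_1 h u - 'D_1 h t0| < eps.
  by move=> hu; apply: hdel; rewrite -ball_normE /= distrC.
wlog hst : s t hs ht / t <= s.
  move=> H; case: (leP t s) => hst; first exact: H.
  rewrite [X in _ <= _ * X]distrC.
  rewrite (_ : h s - h t - 'D_1 h t0 * (s - t) = - (h t - h s - 'D_1 h t0 * (t - s))); last by ring.
  by rewrite normrN; apply: H => //; apply: ltW.
have hin u : u \in `[t, s] -> `|u - t0| < del.
  rewrite in_itv /= => /andP[h1 h2]; move: hs ht; rewrite !ltr_norml => /andP[? ?] /andP[? ?].
  by apply/andP; split; lra.
have [||c hc1 ->] := @MVT_segment R h ('D_1 h) t s hst.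
- move=> u hu; apply: DeriveDef => //; apply: (hb u _).1; apply: hin.
  by move: hu; rewrite !in_itv /= => /andP[h1 h2]; rewrite !ltW.
- apply: derivable_within_continuous => u hu; exact: (hb u (hin u hu)).1.
rewrite -mulrBl normrM ler_wpM2r //; exact/ltW/(hb c (hin c hc1)).2.
Qed.

Definition C1_at (gam : R -> 'rV[R]_2) (t0 : R) :=
  (\forall t \near t0, derivable gam t 1) /\ {for t0, continuous ('D_1 gam)}.

Lemma C1_coord gam t0 i : C1_at gam t0 ->
  forall eps, 0 < eps -> exists2 del, 0 < del & forall s t,
    `|s - t0| < del -> `|t - t0| < del ->
    `|gam s 0 i - gam t 0 i - 'D_1 gam t0 0 i * (s - t)| <= eps * `|s - t|.
Proof.
move=> [h1 h2].
have e t : derivable gam t 1 -> 'D_1 (fun t => gam t 0 i) t = 'D_1 gam t 0 i.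
  by move=> h; rewrite derive_mx // mxE.
rewrite -(e _ (nbhs_singleton h1)); apply: C1_strict.
  by apply: filterS h1 => t /derivable_mxP.
rewrite /prop_for /continuous_at (e _ (nbhs_singleton h1)).
apply: cvg_trans (_ : ('D_1 gam t) 0 i @[t --> t0] --> _); last first.
  apply: (@continuous_comp _ _ _ ('D_1 gam) (fun M : 'rV[R]_2 => M 0 i)) => //.
  exact: coord_continuous.
by apply: near_eq_cvg; apply: filterS h1 => t /e ->.
Qed.

Lemma smooth_C1 (A : set R) gam t0 : nbhs t0 A -> smooth_on A gam -> C1_at gam t0.
Proof.
move=> hA hs; split.
  by apply: filterS hA => t /(hs [::]) h; apply: diff_derivable.
have := hs [:: 1] t0 (nbhs_singleton hA) => /= h.
exact: differentiable_continuous.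
Qed.

(** The chain rule expresses the derivative of [W] through the partial derivatives of [L], which are
    continuous because [smooth_on] makes them differentiable. *)
Lemma C1_comp (A : set R) (w : R -> 'rV[R]_2) (B : set 'rV[R]_2) (L : 'rV[R]_2 -> 'rV[R]_2) W t0 :
  nbhs t0 A -> smooth_on A w -> smooth_on B L -> (forall t, A t -> B (w t)) ->
  (forall t, A t -> W t = L (w t)) -> C1_at W t0.
Proof.
move=> hA hw hL hB hW.
have hnear : \forall t \near t0, \forall u \near t, W u = (L \o w) u.
  have : \forall t \near t0, nbhs t A by exact: nbhs_interior hA.
  by apply: filterS => t; apply: filterS => u hu; apply: hW.
have hd t : A t -> differentiable (L \o w) t.
  by move=> ht; apply: differentiable_comp; [apply: (hw [::])|apply: (hL [::]); apply: hB].
have hD t : A t -> 'D_1 (L \o w) t = \sum_j ('D_1 w t) 0 j *: 'D_(delta_mx 0 j) L (w t).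
  move=> ht; have hwt := hw [::] t ht; have hLt := hL [::] _ (hB t ht).
  have -> : 'D_1 (L \o w) t = 'd L (w t) ('D_1 w t).
    rewrite (deriveE _ (hd t ht)) (deriveE _ hwt).
    exact: (congr1 (fun F : R -> 'rV[R]_2 => F 1) (diff_comp hwt hLt)).
  rewrite {1}(row_sum_delta ('D_1 w t)).
  rewrite linear_sum; apply: eq_bigr => j _.
  by rewrite linearZ (deriveE _ hLt).
have hderW : \forall t \near t0, derivable W t 1.
  apply: filterS (filterI hnear hA) => t [ht At].
  apply: (@near_eq_derivable _ _ _ (L \o w)); first by apply: filterS ht => u ->.
  exact: diff_derivable (hd t At).
split => //.
have he : \forall t \near t0, 'D_1 W t = \sum_j ('D_1 w t) 0 j *: 'D_(delta_mx 0 j) L (w t).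
  by apply: filterS (filterI hnear hA) => t [ht At]; rewrite (near_eq_derive _ ht) (hD t At).
rewrite /prop_for /continuous_at (nbhs_singleton he).
apply: cvg_trans (_ : (\sum_j ('D_1 w t) 0 j *: 'D_(delta_mx 0 j) L (w t)) @[t --> t0] --> _).
  by apply: near_eq_cvg; apply: filterS he => t ->.
have At0 := nbhs_singleton hA.
have cw : {for t0, continuous w} by apply: differentiable_continuous; apply: (hw [::]).
apply: cvg_big => [|j _]; first exact: add_continuous.
apply: cvgZ.
  apply: (@continuous_comp _ _ _ ('D_1 w) (fun M : 'rV[R]_2 => M 0 j)).
    exact: differentiable_continuous (hw [:: 1] _ At0).
  exact: coord_continuous.
apply: (@continuous_comp _ _ _ w ('D_(delta_mx 0 j) L)) => //.
exact: differentiable_continuous (hL [:: delta_mx 0 j] _ (hB _ At0)).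
Qed.

End C1.

(** Here [D] and [E] stand for increments of the parameter of the segment before and after the map,
    and [F] for that of a chart coordinate of the image point. *)
Lemma quotient_estimate (R : realFieldType) (a b : R) : a != 0 ->
  forall eps, 0 < eps -> exists2 e, 0 < e & forall F D E : R,
    `|F - b * D| <= e * `|D| -> `|F - a * E| <= e * `|E| -> `|E - b / a * D| <= eps * `|D|.
Proof.
move=> an0 eps eps0; have a0 : 0 < `|a| by rewrite normr_gt0.
(* The constant in [|E| <= C * |D|], obtained by absorbing [e * |E|] into half of [|a| * |E|]. *)
pose C := 2 / `|a| * (`|b| + 1).
have C0 : 0 <= C by rewrite mulr_ge0 // ?divr_ge0 // ?addr_ge0.
pose e := Num.min (Num.min 1 (`|a| / 2)) (eps * `|a| / (C + 1)).
have e0 : 0 < e by rewrite !lt_min ltr01 !divr_gt0 ?mulr_gt0 //; lra.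
have e1 : e <= 1 by rewrite !ge_min lexx.
have e2 : e <= `|a| / 2 by rewrite !ge_min lexx orbT.
have e3 : e * (C + 1) <= eps * `|a|.
  by rewrite -ler_pdivlMr ?ge_min ?lexx ?orbT //; lra.
exists e => // F D E h1 h2.
have h3 : `|a * E| <= `|F - a * E| + `|F - b * D| + `|b * D|.
  have {1}-> : a * E = - (F - a * E) + (F - b * D) + b * D by ring.
  apply: le_trans (ler_normD _ _) _; rewrite lerD2r.
  by apply: le_trans (ler_normD _ _) _; rewrite normrN.
have h4 : `|a * E - b * D| <= `|F - a * E| + `|F - b * D|.
  have {1}-> : a * E - b * D = - (F - a * E) + (F - b * D) by ring.
  by apply: le_trans (ler_normD _ _) _; rewrite normrN.
rewrite !normrM in h3.
have h5 : e * `|E| <= `|a| / 2 * `|E| by rewrite ler_wpM2r.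
have h6 : e * `|D| <= 1 * `|D| by rewrite ler_wpM2r.
have hE : `|E| <= C * `|D| by rewrite /C -mulrA -ler_pdivrMl ?divr_gt0 // invf_div; lra.
rewrite -(ler_pM2l a0) -normrM (_ : a * (E - b / a * D) = a * E - b * D); last by field.
apply: le_trans h4 _; apply: le_trans (lerD h2 h1) _.
have h7 : e * `|E| <= e * (C * `|D|) by rewrite ler_pM2l.
have h8 : e * (C + 1) * `|D| <= eps * `|a| * `|D| by rewrite ler_wpM2r.
lra.
Qed.

Section Embedding.
Variables (R : realType) (S : surface R) (g : R -> S).
Hypothesis hg : smooth_embedding01 g.

Lemma embedding_continuous t : t \in `[0, 1] -> {for t, continuous g}.
Proof. by move=> ht; have [[U [_ sU cg _]] _ _] := hg; apply/cg/sU. Qed.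

Lemma embedding_compact (A : set R) : A `<=` `[0, 1]%classic -> closed A -> closed (g @` A).
Proof.
move=> hA cA; apply: compact_closed; first exact: surface_hausdorff.
apply: continuous_compact.
  apply: continuous_in_subspaceT => t; rewrite inE => /hA; exact: embedding_continuous.
rewrite -(setIidr hA); apply: compact_closedI => //; exact: segment_compact.
Qed.

(** Continuity of the inverse of the embedding: the parameters at distance at least [eps] from [t1]
    form a compact set, whose image is closed and misses [g t1]. *)
Lemma embedding_inv t1 eps : t1 \in `[0, 1] -> 0 < eps ->
  exists2 B : set S, nbhs (g t1) B & forall t, t \in `[0, 1] -> B (g t) -> `|t - t1| < eps.
Proof.
move=> ht1 eps0; pose B := `[0, 1]%classic `&` ~` ball t1 eps.
exists (~` (g @` B)); last first.
  move=> t ht hO; rewrite ltNge; apply/negP => h; apply: hO; exists t => //; split => //.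
  by rewrite -ball_normE /= distrC ltNge h.
apply: open_nbhs_nbhs; split.
  apply: closed_openC; apply: embedding_compact; first by move=> t [].
  by apply: closedI; [exact: itv_closed|apply: open_closedC; apply: ball_open].
move=> [t [ht hb] e]; apply: hb; have [_ inj _] := hg.
by rewrite (inj _ _ ht ht1 e); apply: ballxx.
Qed.

Lemma embedding_C1 (c : chart R S) t : atlas c -> t \in `[0, 1] -> chart_dom c (g t) ->
  C1_at (c \o g) t.
Proof.
move=> hc ht hd; have [[U [oU sU cg sg]] _ _] := hg.
apply: (smooth_C1 _ (sg _ hc)); apply: filterI; first by apply: open_nbhs_nbhs; split => //; apply: sU.
by apply: (cg _ (sU _ ht)); apply: open_nbhs_nbhs; split => //; apply: open_chart_dom.
Qed.

Lemma embedding_image_C1 (c c' : chart R S) (f : S -> S) t : smooth_map_on setT f ->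
  atlas c -> atlas c' -> t \in `[0, 1] -> chart_dom c (g t) -> chart_dom c' (f (g t)) ->
  C1_at (c' \o f \o g) t.
Proof.
move=> [cf sf] hc hc' ht hd hd'; have [[U [oU sU cg sg]] _ _] := hg.
pose A := (U `&` g @^-1` chart_dom c) `&` (f \o g) @^-1` chart_dom c'.
apply: (@C1_comp _ A (c \o g) (local_dom c c' f setT) (local_rep c c' f)).
- apply: filterI; first apply: filterI.
  + by apply: open_nbhs_nbhs; split => //; apply: sU.
  + by apply: (cg _ (sU _ ht)); apply: open_nbhs_nbhs; split => //; apply: open_chart_dom.
  + have h : {for t, continuous (f \o g)} by apply: continuous_comp; [apply/cg/sU|apply: cf].
    by apply: h; apply: open_nbhs_nbhs; split => //; apply: open_chart_dom.
- by move=> vs s [hs _]; apply: sg.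
- exact: sf.
- by move=> s [[_ h1] h2]; exists (g s).
- by move=> s [[_ h1] h2]; rewrite /local_rep /= chart_mapK.
Qed.

(** In a chart at the image point some coordinate [i] of [g] has nonzero derivative [a]. If [b] is
    the derivative of the same coordinate of [f \o g], the induced map has derivative [b / a]. *)
Lemma strict_of_smooth (l : R) (f : S -> S) (phi : stream -> stream) : 0 < l < 1 / 2 ->
  smooth_map_on setT f -> (forall x, f (g (cpt l x)) = g (cpt l (phi x))) ->
  forall x, exists d, strict_at l phi x d.
Proof.
move=> hl hf hphi x; pose t0 := cpt l x; pose t1 := cpt l (phi x).
have h01 y : cpt l y \in `[0, 1] by apply: ternary_cantor01.
have [c hc cd] := atlas_cover (g t0).
have [c' hc' cd'] := atlas_cover (g t1).
have hV := embedding_C1 hc' (h01 (phi x)) cd'.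
have hW : C1_at (c' \o f \o g) t0.
  by apply: (embedding_image_C1 hf hc hc' (h01 x) cd); rewrite hphi.
have [_ _ /(_ c' t1 hc' (h01 _) cd')] := hg; rewrite derive1E => /rV0Pn[i hi].
pose a := 'D_(1 : R) (c' \o g : R -> 'rV[R]_2) t1 0 i; pose b := 'D_(1 : R) (c' \o f \o g : R -> 'rV[R]_2) t0 0 i.
exists (b / a) => eps eps0.
have [e1 e10 he1] := quotient_estimate b (hi : a != 0) eps0.
have [d1 d10 hd1] := C1_coord i hV e10.
have [d2 d20 hd2] := C1_coord i hW e10.
have [B0 hO hOt] := embedding_inv (h01 (phi x)) d10.
have hcont : {for t0, continuous (f \o g)}.
  by apply: continuous_comp; [apply/embedding_continuous/h01|have [cf _] := hf; apply: cf].
have : \forall t \near t0, B0 (f (g t)) by apply: hcont; rewrite /= hphi.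
move=> /nbhs_ballP[d3 /= d30 hd3].
have hd : 0 < Num.min d2 d3 by rewrite lt_min d20.
have [n hn] := exists_small_power hl hd; exists n => y z hy hz.
have near0 w : incyl (pre n x) w -> `|cpt l w - t0| < d2 /\ `|cpt l (phi w) - t1| < d1.
  move=> hw; have := cpt_diam hl (incyl_pre n x) hw; rewrite size_pre -/t0 => h1.
  have := hn n (leqnn n); rewrite lt_min => /andP[h2 h3]; split; first by rewrite distrC; lra.
  apply: hOt => //; rewrite -hphi; apply: hd3; rewrite -ball_normE /=; lra.
have [hy0 hy1] := near0 _ hy; have [hz0 hz1] := near0 _ hz.
have := hd1 _ _ hy1 hz1; have := hd2 _ _ hy0 hz0.
by rewrite /= !hphi; apply: he1.
Qed.

End Embedding.

(** * The action of the mapping class group *)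

Lemma cinfty_nbhs_open (R : realType) (S : surface R) (N : set (selfmap S)) :
  cinfty_subbase N -> open N.
Proof.
move=> hN; exists [set N]; last by rewrite bigcup_set1.
by move=> _ ->; apply: finI_from1.
Qed.

(** Take for [W] the largest open set of maps sending [p] into [B]. It contains every smooth such
    [f], through the subbasic set given by the compact set [[set p]] and no derivative. *)
Lemma evaluation_open (R : realType) (S : surface R) (B : set S) (p : S) : open B ->
  exists2 W : set (selfmap S), open W & forall f : selfmap S, smooth_map_on setT f -> W f <-> B (f p).
Proof.
move=> oB.
exists (\bigcup_(N in [set N : set (selfmap S) | open N /\ forall h : selfmap S, N h -> B (h p)]) N).
  by apply: bigcup_open => N [].
move=> f hf; split=> [[N [_ h] /h //]|hB].
have [c hc cd] := atlas_cover p; have [c' hc' cd'] := atlas_cover (f p).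
have : nbhs (c' (f p)) (chart_inv c' @^-1` B).
  apply: (@chart_inv_continuous _ _ c' (c' (f p))); first by exists (f p).
  by rewrite chart_mapK //; apply: open_nbhs_nbhs.
move=> /nbhs_ballP[e /= e0 he].
exists (cinfty_nbhs f c c' [set p] [::] e); last first.
  split=> [_ [_ -> <-] //|x _]; by rewrite subrr normr0.
split.
  apply: cinfty_nbhs_open; exists f, c, c', [set p], [::], e; split => //; split.
  - exact: compact_set1.
  - by move=> _ ->.
  - by move=> _ [_ -> <-].
move=> h [h1 h2]; have hd : chart_dom c' (h p) by apply: h1; exists p.
rewrite -(chart_mapK hd); apply: he; rewrite -ball_normE /=.
have := h2 p erefl; rewrite /= /local_rep /= (chart_mapK cd) distrC; exact.
Qed.

Section Action.
Variables (R : realType) (S : surface R) (l : R) (g : R -> S).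
Hypothesis hl : 0 < l < 1 / 2.
Hypothesis hg : smooth_embedding01 g.

Let C := g @` ternary_cantor l.
Let gc (x : stream) : S := g (cpt l x).

Let CE : C = range gc.
Proof. by rewrite /C ternary_cantorE // image_comp. Qed.

Let gc_inj : injective gc.
Proof.
move=> x y h; apply: (cpt_inj hl); have [_ inj _] := hg.
by apply: inj h; apply: ternary_cantor01.
Qed.

Lemma Diff_id : Diff C (id : selfmap S).
Proof.
have hid : smooth_map_on setT (id : S -> S).
  by split=> [x _|c c' hc hc']; [exact: cvg_id|exact: atlas_smooth].
split; last exact: image_id.
  by split => //; exists id; split.
by move=> c c' hc hc'; apply: atlas_oriented.
Qed.

(** Both [f] and its inverse are smooth, so [rigid] applies at every point; compactness makes the
    depth uniform. *)
Lemma Diff_vaut f : Diff C f -> exists phi : vaut, forall x, f (gc x) = gc (phi x).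
Proof.
move=> [[sf [k [fK kK sk]]] _ fC].
have hf x : exists y, f (gc x) = gc y.
  have : C (f (gc x)) by rewrite -fC; exists (gc x) => //; rewrite CE; exists x.
  by rewrite CE => -[y _ <-]; exists y.
have hk x : exists y, k (gc x) = gc y.
  have : (f @` C) (gc x) by rewrite fC CE; exists x.
  by rewrite CE => -[_ [y _ <-] <-]; exists y; rewrite fK.
have [phi hphi] := choice hf; have [psi hpsi] := choice hk.
have phiK : cancel phi psi by move=> x; apply: gc_inj; rewrite -hpsi -hphi fK.
have psiK : cancel psi phi by move=> x; apply: gc_inj; rewrite -hphi -hpsi kK.
have hu : exists N, unif N phi.
  apply: unif_local => x.
  have [d hd] := strict_of_smooth hg hl sf hphi x.
  have [d' hd'] := strict_of_smooth hg hl sk hpsi (phi x).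
  by have [u hu] := rigid hl phiK psiK hd hd'; exists u.
by exists (Vaut phiK psiK hu).
Qed.

(* Two distinct points of the Cantor set are separated by the midpoint [tau] of
   a gap, and evaluation at a point is continuous for the C^oo topology. *)
Lemma Diff0_trivial (h : selfmap S) x : Diff0 C h -> h (gc x) = gc x.
Proof.
move=> [A [Aid AD cA] Ah].
have [_ [phi hphi]] : Diff C h /\ exists phi : vaut, forall y, h (gc y) = gc (phi y).
  by split; [apply: AD|apply/Diff_vaut/AD].
rewrite hphi; congr gc; apply: contrapT => hne.
have [u [b [hpx hx]]] := stream_split hne.
pose tau := (cpt l (gapL u) + cpt l (gapR u)) / 2.
have hgap := cpt_gapLR hl u; have gpos := gap_pos hl (size u).
have tauP z : cpt l z < tau \/ tau < cpt l z.
  have := @gap_empty _ _ hl u z; case: (ltgtP (cpt l z) tau) => [|_|e] hz; [by left|by right|].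
  by case: hz; rewrite e /tau; apply/andP; split; lra.
have tau01 : 0 <= tau <= 1.
  by have := cpt_bound hl (gapL u); have := cpt_bound hl (gapR u); rewrite /tau; lra.
pose K (b : bool) := g @` (if b then `[tau, 1]%classic else `[0, tau]%classic).
have cK b' : closed (K b').
  apply: (embedding_compact hg); case: b'; try exact: itv_closed.
    by move=> t /=; rewrite !in_itv /= => /andP[h1 ->]; rewrite andbT; lra.
  by move=> t /=; rewrite !in_itv /= => /andP[-> h1] /=; lra.
have KP b' z : K b' (gc z) <-> (if b' then tau < cpt l z else cpt l z < tau).
  have [_ inj _] := hg.
  have hz := ternary_cantor01 hl z.
  have := cpt_bound hl z => /andP[z0 z1].
  split.
    case: b' => -[t]; rewrite /= in_itv /= => /andP[t1 t2] /inj e.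
      have et : t = cpt l z by apply: e => //; rewrite in_itv /=; lra.
      by have := tauP z; lra.
    have et : t = cpt l z by apply: e => //; rewrite in_itv /=; lra.
    by have := tauP z; lra.
  by case: b' => hz'; exists (cpt l z) => //=; rewrite in_itv /=; lra.
have KN b' z : K b' (gc z) <-> ~ K (~~ b') (gc z).
  rewrite !KP; case: b' => /=; have := tauP z; lra.
have side b' z : incyl (rcons u b') z -> K b' (gc z).
  move=> hz; apply/KP; case: b' hz => hz.
    by have := gapR_min hl hz; rewrite /tau; lra.
  by have := gapL_max hl hz; rewrite /tau; lra.
have smA f : A f -> smooth_map_on setT f by move=> /AD[[]].
have imA f : A f -> exists y, f (gc x) = gc y.
  by move=> /AD/Diff_vaut[psi hpsi]; exists (psi x).
have [W oW hW] := evaluation_open (gc x) (closed_openC (cK b)).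
have [W' oW' hW'] := evaluation_open (gc x) (closed_openC (cK (~~ b))).
(* No point of the Cantor set sits at [tau], so on [A] lying in [W] is the same as not lying in
   [W']: the trace of [W] is clopen and contains the identity. *)
have : A `&` W = A.
  apply: cA.
  - exists id; split => //; apply/hW; first exact: smA.
    by have := side _ _ hx; rewrite KN negbK.
  - by exists W.
  - exists (~` W'); first exact: open_closedC.
    apply/seteqP; split=> f [Af Wf]; split => //; have [y ey] := imA f Af.
      move=> /(hW' f (smA f Af)); move: Wf => /(hW f (smA f Af)).
      by rewrite /= ey => h1 h2; apply: h1; apply/KN.
    apply/(hW f (smA f Af)); rewrite /= ey => hb; apply: Wf; apply/(hW' f (smA f Af)).
    by rewrite /= ey; apply: (KN b y).1.
move=> e; have : (A `&` W) h by rewrite e.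
move=> [_ /(hW h (smA h Ah))]; rewrite /= hphi; apply; exact: side.
Qed.

(** Nonemptiness of [A] makes [phi] unique. *)
Definition acts (A : set (selfmap S)) (phi : vaut) : Prop :=
  A !=set0 /\ forall f : selfmap S, A f -> forall x, f (gc x) = gc (phi x).

Lemma acts_uniq A phi psi : acts A phi -> acts A psi -> phi = psi.
Proof.
move=> [[f Af] h] [_ h']; apply: vaut_eq => x; apply: gc_inj.
by rewrite -(h f Af) (h' f Af).
Qed.

Lemma mcg_acts A : mcg C A -> exists phi, acts A phi.
Proof.
move=> [f Df <-]; have [phi hphi] := Diff_vaut Df; exists phi; split.
  by exists f, id => //; apply: connected_component_refl; apply: Diff_id.
by move=> _ [h Dh <-] x /=; rewrite (Diff0_trivial _ Dh).
Qed.

Lemma acts_one : acts (Diff0 C) v1.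
Proof.
split; last by move=> h Dh x; rewrite (Diff0_trivial _ Dh).
by exists id; apply: connected_component_refl; apply: Diff_id.
Qed.

Lemma acts_mul A B phi psi : acts A phi -> acts B psi -> acts (mcg_mul A B) (vM phi psi).
Proof.
move=> [[f Af] hA] [[h Bh] hB]; split; first by exists ((f : S -> S) \o h), f => //; exists h.
by move=> _ [f' Af' [h' Bh' <-]] x; rewrite /= (hB _ Bh') (hA _ Af').
Qed.

Lemma acts_inv A phi : mcg_inv A !=set0 -> acts A phi -> acts (mcg_inv A) (vV phi).
Proof.
move=> hne [_ hA]; split => // k [f Af [fK _]] x.
by rewrite -{1}(vEV phi x) -(hA f Af) fK.
Qed.

Lemma mcg_nonempty A : mcg C A -> A !=set0.
Proof. by move=> /mcg_acts[phi []]. Qed.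

Lemma subgroup_gen (G F : set (set (selfmap S))) (P : vaut -> Prop) :
  is_subgroup C G -> F `<=` G -> G = smallest (is_subgroup C) F ->
  (forall s, P s -> P (vV s)) -> (forall A phi, F A -> acts A phi -> P phi) ->
  forall A phi, G A -> acts A phi -> gen P phi.
Proof.
move=> [G1 G2 G3 G4] FG Gs PV hF.
(* [M] is a subgroup containing [F], so the minimality of [G] gives the inclusion. *)
pose M := [set A | G A /\ forall phi, acts A phi -> gen P phi].
suff GM : G `<=` M by move=> A phi /GM[_]; apply.
rewrite {1}Gs; apply: smallest_sub; last first.
  by move=> A FA; split; [apply: FG|move=> phi h; apply/gen_incl/hF/h].
split.
- by move=> A [/G1].
- by split => // phi h; rewrite (acts_uniq h acts_one); apply: gen_one.
- move=> A B [GA hA] [GB hB]; split; first exact: G3.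
  move=> phi h; have [a ha] := mcg_acts (G1 _ GA); have [b hb] := mcg_acts (G1 _ GB).
  by rewrite (acts_uniq h (acts_mul ha hb)); apply: genM; [apply: hA|apply: hB].
- move=> A [GA hA]; have GV := G4 _ GA; split => // phi h.
  have [a ha] := mcg_acts (G1 _ GA).
  by rewrite (acts_uniq h (acts_inv (mcg_nonempty (G1 _ GV)) ha)); apply: genV => //; apply: hA.
Qed.

Lemma eval_word_acts (A B : set (selfmap S)) a b w :
  acts A a -> acts B b -> mcg_inv A !=set0 -> mcg_inv B !=set0 ->
  acts (eval_word C A B w) (foldr (fun s c => vM (letter a b s) c) v1 w).
Proof.
move=> ha hb hA hB; elim: w => [|[i j] w IH] /=; first exact: acts_one.
apply: acts_mul IH; rewrite /letter /=.
by case: i; case: j => //; apply: acts_inv.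
Qed.

Lemma word_fold a b w x : foldr (fun s c => vM (letter a b s) c) v1 w x = word a b w x.
Proof. by elim: w => //= s w ->. Qed.

Lemma finite_uniform_depth (F : set (set (selfmap S))) :
  finite_set F -> exists N, forall A phi, F A -> acts A phi -> unif N phi /\ unif N (vV phi).
Proof.
move=> Ffin.
have /choice[N hN] A : exists N, forall phi, acts A phi -> unif N phi /\ unif N (vV phi).
  have [[phi h]|hn] := pselect (exists phi, acts A phi); last first.
    by exists 0%N => phi h; case: hn; exists phi.
  have [n hn] := vunif phi; have [m hm] := vunif (vV phi); exists (maxn n m) => psi h'.
  rewrite -(acts_uniq h h'); split=> u hu; [apply: hn|apply: hm]; apply: leq_trans hu.
    exact: leq_maxl.
  exact: leq_maxr.
have /finite_seqP[s hs] := finite_image N Ffin.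
exists (\max_(i <- s) i)%N => A phi FA h.
have hle : (N A <= \max_(i <- s) i)%N.
  have hin : N A \in s by have : (N @` F) (N A) by [exists A]; rewrite hs.
  exact: leq_bigmax_seq.
by have [h1 h2] := hN A phi h; split=> u hu; [apply: h1|apply: h2]; apply: leq_trans hle hu.
Qed.

Lemma tits_alternative (G : set (set (selfmap S))) :
  is_subgroup C G -> finitely_generated C G ->
  contains_free2 C G \/ exists2 p, C p & finite_set (mcg_orbit G p).
Proof.
move=> sG [F [Ffin FG Gs]]; have [G1 G2 G3 G4] := sG.
have [N hN] := finite_uniform_depth Ffin.
(* The maps induced by the generators, together with their inverses because [gen] only takes
   products. *)
pose P phi := exists A, F A /\ (acts A phi \/ acts A (vV phi)).
have PV s : P s -> P (vV s).
  by move=> [A [FA h]]; exists A; split => //; rewrite vVK; case: h; [right|left].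
have PN s : P s -> unif N s.
  by move=> [A [FA [h|h]]]; have [h1 h2] := hN _ _ FA h; rewrite ?vVK in h1 h2 *.
have Pgen : forall A phi, G A -> acts A phi -> gen P phi.
  by apply: (subgroup_gen sG FG Gs PV) => A phi FA h; exists A; split => //; left.
have GenG h : gen P h -> exists2 A, G A & acts A h.
  elim=> [|s k [A [FA hs]] _ [B GB hB]]; first by exists (Diff0 C) => //; apply: acts_one.
  case: hs => hs; first by exists (mcg_mul A B); [apply: G3 => //; apply: FG|apply: acts_mul].
  have GV := G4 _ (FG _ FA); exists (mcg_mul (mcg_inv A) B); first exact: G3.
  by apply: acts_mul hB; rewrite -(vVK s); apply: acts_inv hs; apply/mcg_nonempty/G1.
have [[a [b [ga gb hfree]]]|[x [s hs]]] := stream_alternative PN PV.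
  left; have [A GA hA] := GenG _ ga; have [B GB hB] := GenG _ gb.
  exists A, B; split => // w wn wr e.
  (* A word equal to the unit class would act as the identity, but this one moves [x]. *)
  have [x] := hfree w wn wr; apply; rewrite -word_fold.
  have := eval_word_acts w hA hB (mcg_nonempty (G1 _ (G4 _ GA))) (mcg_nonempty (G1 _ (G4 _ GB))).
  by rewrite e => h; rewrite (acts_uniq h acts_one).
right; exists (gc x); first by rewrite CE; exists x.
apply: (@sub_finite_set _ _ (gc @` [set` s])); last exact/finite_image/finite_seq.
move=> _ [A [f [GA Af ->]]]; have [phi hphi] := mcg_acts (G1 _ GA).
by exists (phi x); [apply: hs; apply: Pgen GA hphi|rewrite (hphi.2 f Af)].
Qed.

End Action.

Theorem theorem1p3 (R : realType) (S : surface R) (hS : finite_type S)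
    (l : R) (hl : 0 < l < 1 / 2) (g : R -> S) (hg : smooth_embedding01 g)
    (G : set (set (selfmap S))) :
  let C := g @` ternary_cantor l in
  is_subgroup C G -> finitely_generated C G ->
  contains_free2 C G \/ exists2 p, C p & finite_set (mcg_orbit G p).
Proof. exact: tits_alternative. Qed.
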